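(* Let $n\ge 2$, let $\{S,T\}$ be a partition of $\{1,\dots,2n\}$ into two nonempty sets, and let $\mathcal G=sp(2n,\mathbb C)$ act on $\mathcal A=\mathbb C[x_1,\dots,x_{2n}]$ by the representation attached to $(S,T)$ described in the context. (1) If $S_1\cup T_1\neq\emptyset$, then $\mathcal A_{\langle k\rangle}$ is an irreducible $\mathcal G$-module for every $k\in\mathbb Z$. Moreover: (a) If $S_1\ne\emptyset$ and $T_1\neq\emptyset$, then the irreducible modules $\mathcal A_{\langle k\rangle}$ ($k\in\mathbb Z$) are not of highest weight type. (b) If $S_1=\emptyset$ or $T_1=\emptyset$, normalized (by symmetry) so that $T=\{1,\dots,t\}$ for some $t\in\{1,\dots,n-1\}$, then $\mathcal A_{\langle k\rangle}$ is an irreducible highest weight module; for $k\ge 0$ a highest weight vector is $x_{t+1}^k$ and the highest weight is $-(k+1)\lambda_t+k\lambda_{t+1}$, and for $k<0$ a highest weight vector is $x_t^{-k}$ and the highest weight is $-k\lambda_{t-1}+(k-1)\lambda_t$. (2) If $S_1\cup T_1=\emptyset$, normalized (by symmetry) so that $T_2=\{1,\dots,n\}$, i.e. $T=\{1,\dots,n\}$ and $S=\{n+1,\dots,2n\}$, then: (e) For $k>0$, $\mathcal A_{\langle k\rangle}$ (resp. $\mathcal A_{\langle -k\rangle}$) is an irreducible highest weight module with highest weight $k\lambda_{n-1}-(k+1)\lambda_n$ and a corresponding highest weight vector $x_{2n}^k$ (resp. $x_n^{k}$). (f) $\mathcal A_{\langle 0\rangle}=U(\mathcal G).1\oplus U(\mathcal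 G).(x_{n-1}x_{2n}-x_nx_{2n-1})$. Both $U(\mathcal G).1$ and $U(\mathcal G).(x_{n-1}x_{2n}-x_nx_{2n-1})$ are irreducible highest weight modules, with highest weights $-\lambda_n$ and $-2\lambda_n$, respectively. For nonnegative integers $k_t$ ($1\le t\le n$) with $\sum_t k_t$ even and $k_{i,j}$ ($1\le i<j\le n$), put $$P_{(k_t),(k_{i,j})}=\sum_{\substack{r_1,\dots,r_n\in\mathbb N\\ r_1+\cdots+r_n=\frac12(k_1+\cdots+k_n)}}(r_1+\cdots+r_n)!\prod_{t=1}^n\binom{k_t}{r_t}x_t^{k_t-r_t}x_{n+t}^{r_t}\prod_{1\le i<j\le n}(x_ix_{n+j}-x_jx_{n+i})^{k_{i,j}}.$$ Then $U(\mathcal G).1$ has as basis the set of all $P_{(k_t),(k_{i,j})}$ with $k_t,k_{i,j}\in\mathbb N$, $\sum_{t=1}^nk_t\in2\mathbb N$, $\sum_{i<j}k_{i,j}\in 2\mathbb N$, $k_{i,j}k_t=0$ whenever $i<j<t$, and $k_{i,j}k_{i_1,j_1}=0$ whenever $i<i_1$ and $j>j_1$; and $U(\mathcal G).(x_{n-1}x_{2n}-x_nx_{2n-1})$ has as basis the set of all $P_{(k_t),(k_{i,j})}$ satisfying the same conditions except that $\sum_{i<j}k_{i,j}\in 2\mathbb N$ is replaced by $\sum_{i<j}k_{i,j}\notin 2\mathbb N$.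
   Context: $\mathbb N$ denotes the nonnegative integers. $E_{i,j}$ are the matrix units of size $2n$. $$\mathcal G=sp(2n,\mathbb C)=\sum_{i,j=1}^n\mathbb C(E_{i,j}-E_{n+j,n+i})+\sum_{1\le i\le j\le n}[\mathbb C(E_{n+i,j}+E_{n+j,i})+\mathbb C(E_{i,n+j}+E_{j,n+i})],$$ and $U(\mathcal G)$ is its universal enveloping algebra. The Cartan subalgebra is $H=\sum_{i=1}^n\mathbb C(E_{i,i}-E_{n+i,n+i})$; positive root vectors are $E_{i,j}-E_{n+j,n+i}$, $E_{i,n+j}+E_{j,n+i}$ ($1\le i<j\le n$) and $E_{i,n+i}$ ($1\le i\le n$), spanning $\mathcal G_+$. $\lambda_i$ is the $i$-th fundamental weight: $\lambda_i=\varepsilon_1+\dots+\varepsilon_i$ where $\varepsilon_i(E_{j,j}-E_{n+j,n+j})=\delta_{i,j}$; $\lambda_0=0$. The representation attached to $(S,T)$ is the restriction to $\mathcal G$ of the representation of $gl(2n,\mathbb C)$ on $\mathcal A$ given by: $E_{i,j}=x_i\partial_{x_j}$ if $i,j\in S$; $E_{i,j}=-x_ix_j$ if $i\in S,\ j\in T$; $E_{i,j}=\partial_{x_i}\partial_{x_j}$ if $i\in T,\ j\in S$; $E_{i,j}=-x_j\partial_{x_i}-\delta_{i,j}$ if $i,j\in T$. $\mathcal A_{\langle k\rangle}=\mathrm{Span}\{x^\alpha\mid\alpha\in\mathbb N^{2n},\ \sum_{i\in S}\alpha_i-\sum_{r\in T}\alpha_r=k\}$, a $\mathcal G$-submodule.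 $S_1=\{i\in\{1,\dots,n\}: i\in S,\ n+i\in S\}$, $S_2=\{i\in\{1,\dots,n\}: i\in S,\ n+i\in T\}$, $T_1=\{i\in\{1,\dots,n\}: i\in T,\ n+i\in T\}$, $T_2=\{i\in\{1,\dots,n\}: i\in T,\ n+i\in S\}$. A singular vector is a nonzero $f$ with $H.f\subset\mathbb Cf$ and $\mathcal G_+.f=0$. A module is a highest weight module (of highest weight type) if it is generated by a singular vector, which is then called a highest weight vector and whose weight is the highest weight.
   Formalization: In (f), the highest weight of U(G).(x_{n-1}x_{2n}-x_nx_{2n-1}) is corrected from -2λ_n to λ_{n-2}-2λ_n; the two agree for n=2, and the printed weight is false for every n≥3, since H_i acts by -1 on the generator when i≤n-2. *)

(* Defs.v *)
From HB Require Import structures.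
From mathcomp Require Import all_boot all_order all_algebra.
From mathcomp Require Import reals.
From mathcomp Require Export complex.
From mathcomp Require Export mpoly.

Set Implicit Arguments.
Unset Strict Implicit.
Unset Printing Implicit Defensive.

Import Order.TTheory GRing.Theory Num.Theory.

Local Open Scope ring_scope.

(* The field C of complex numbers is [R[i]] for a [realType] R.  The index set
   {1, ..., 2n} is ['I_(n + n)]: for [i : 'I_n] (0-based), the indices i and
   n + i of the text are [lshift n i] and [rshift n i]. *)

(* ------------------------------------------------------------------------ *)

Definition lspan (K : fieldType) (V : lmodType K) (P : V -> Prop) (v : V) :
    Prop :=
  exists (m : nat) (c : 'I_m -> K) (w : 'I_m -> V),
    (forall i, P (w i)) /\ v = \sum_(i < m) c i *: w i.

Definition is_subspace (K : fieldType) (V : lmodType K) (W : V -> Prop) : Prop :=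
  W 0 /\ forall (c : K) (u v : V), W u -> W v -> W (c *: u + v).

Definition is_direct_sum (K : fieldType) (V : lmodType K) (W U1 U2 : V -> Prop) :
    Prop :=
  (forall w, W w <-> exists u1 u2, [/\ U1 u1, U2 u2 & w = u1 + u2]) /\
  (forall u, U1 u -> U2 u -> u = 0).

(* The family (b i), for i ranging over D, is a basis of W. *)
Definition is_basis (K : fieldType) (V : lmodType K) (I : eqType) (D : pred I)
    (b : I -> V) (W : V -> Prop) : Prop :=
  (forall (s : seq I) (c : I -> K), uniq s -> all D s ->
     \sum_(i <- s) c i *: b i = 0 -> forall i, i \in s -> c i = 0) /\
  (forall w, W w <-> lspan (fun v => exists2 i, D i & v = b i) w).

(* ------------------------------------------------------------------------ *)

Definition sp_gen (R : realType) (n : nat) (M : 'M[R[i]]_(n + n)) : Prop :=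
  [\/ exists i j : 'I_n,
        M = delta_mx (lshift n i) (lshift n j)
            - delta_mx (rshift n j) (rshift n i),
      exists i j : 'I_n, (i <= j)%N /\
        M = delta_mx (rshift n i) (lshift n j)
            + delta_mx (rshift n j) (lshift n i)
    | exists i j : 'I_n, (i <= j)%N /\
        M = delta_mx (lshift n i) (rshift n j)
            + delta_mx (lshift n j) (rshift n i)].

Definition sp_alg (R : realType) (n : nat) : 'M[R[i]]_(n + n) -> Prop :=
  lspan (@sp_gen R n).

Definition cartan (R : realType) (n : nat) : 'M[R[i]]_(n + n) -> Prop :=
  lspan (fun M => exists i : 'I_n,
    M = delta_mx (lshift n i) (lshift n i)
        - delta_mx (rshift n i) (rshift n i)).

Definition pos_root_vector (R : realType) (n : nat) (M : 'M[R[i]]_(n + n)) :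
    Prop :=
  [\/ exists i j : 'I_n, (i < j)%N /\
        M = delta_mx (lshift n i) (lshift n j)
            - delta_mx (rshift n j) (rshift n i),
      exists i j : 'I_n, (i < j)%N /\
        M = delta_mx (lshift n i) (rshift n j)
            + delta_mx (lshift n j) (rshift n i)
    | exists i : 'I_n, M = delta_mx (lshift n i) (rshift n i)].

Definition sp_plus (R : realType) (n : nat) : 'M[R[i]]_(n + n) -> Prop :=
  lspan (@pos_root_vector R n).

(* A weight sum_i mu_i eps_i is given by its coordinates mu_i; its value at
   h in H uses eps_i(h) = h_{i,i}. *)
Definition wt_eval (R : realType) (n : nat) (mu : 'rV[R[i]]_n)
    (h : 'M[R[i]]_(n + n)) : R[i] :=
  \sum_(i < n) mu 0 i * h (lshift n i) (lshift n i).

(* lambda_m = eps_1 + ... + eps_m (eps_1 has 0-based index 0). *)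
Definition fund_wt (R : realType) (n m : nat) : 'rV[R[i]]_n :=
  \row_(i < n) (i < m)%N%:R.

(* ------------------------------------------------------------------------ *)

(* In all that follows T is the complement of S. *)

Definition gl_unit_act (R : realType) (n : nat) (S : {set 'I_(n + n)})
    (i j : 'I_(n + n)) (f : {mpoly R[i][n + n]}) : {mpoly R[i][n + n]} :=
  match i \in S, j \in S with
  | true, true => 'X_i * f^`M(j)
  | true, false => - ('X_i * 'X_j * f)
  | false, true => (f^`M(j))^`M(i)
  | false, false => - ('X_j * f^`M(i)) - (i == j)%:R *: f
  end.

Definition gl_act (R : realType) (n : nat) (S : {set 'I_(n + n)})
    (M : 'M[R[i]]_(n + n)) (f : {mpoly R[i][n + n]}) : {mpoly R[i][n + n]} :=
  \sum_(i < n + n) \sum_(j < n + n) M i j *: gl_unit_act S i j f.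

Definition is_submodule (R : realType) (n : nat) (S : {set 'I_(n + n)})
    (W : {mpoly R[i][n + n]} -> Prop) : Prop :=
  is_subspace W /\ forall M f, sp_alg M -> W f -> W (gl_act S M f).

Definition irreducible_module (R : realType) (n : nat) (S : {set 'I_(n + n)})
    (W : {mpoly R[i][n + n]} -> Prop) : Prop :=
  [/\ is_submodule S W,
      exists2 f, W f & f != 0
    & forall W' : {mpoly R[i][n + n]} -> Prop,
        is_submodule S W' -> (forall f, W' f -> W f) ->
        (forall f, W' f -> f = 0) \/ (forall f, W f -> W' f)].

(* U(G).v: the enveloping algebra is spanned by the products g_1 ... g_r of
   elements of G (r >= 0), which act by composition. *)
Definition U_orbit (R : realType) (n : nat) (S : {set 'I_(n + n)})
    (v : {mpoly R[i][n + n]}) : {mpoly R[i][n + n]} -> Prop :=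
  lspan (fun f => exists gs : seq 'M[R[i]]_(n + n),
    (forall g, g \in gs -> sp_alg g) /\ f = foldr (gl_act S) v gs).

Definition weight_vector (R : realType) (n : nat) (S : {set 'I_(n + n)})
    (f : {mpoly R[i][n + n]}) (mu : 'rV[R[i]]_n) : Prop :=
  forall h, cartan h -> gl_act S h f = wt_eval mu h *: f.

Definition singular_vector (R : realType) (n : nat) (S : {set 'I_(n + n)})
    (f : {mpoly R[i][n + n]}) : Prop :=
  [/\ f != 0,
      forall h, cartan h -> exists c, gl_act S h f = c *: f
    & forall e, sp_plus e -> gl_act S e f = 0].

Definition generates (R : realType) (n : nat) (S : {set 'I_(n + n)})
    (f : {mpoly R[i][n + n]}) (W : {mpoly R[i][n + n]} -> Prop) : Prop :=
  forall g, W g <-> U_orbit S f g.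

Definition hw_type (R : realType) (n : nat) (S : {set 'I_(n + n)})
    (W : {mpoly R[i][n + n]} -> Prop) : Prop :=
  exists f, singular_vector S f /\ generates S f W.

(* W is a highest weight module with highest weight vector f and highest
   weight mu. *)
Definition hw_module (R : realType) (n : nat) (S : {set 'I_(n + n)})
    (W : {mpoly R[i][n + n]} -> Prop) (f : {mpoly R[i][n + n]})
    (mu : 'rV[R[i]]_n) : Prop :=
  [/\ singular_vector S f, weight_vector S f mu & generates S f W].

Definition graded_piece (R : realType) (n : nat) (S : {set 'I_(n + n)})
    (k : int) : {mpoly R[i][n + n]} -> Prop :=
  lspan (fun f => exists2 a : 'X_{1.. n + n},
    \sum_(i in S) (a i)%:Z - \sum_(r in ~: S) (a r)%:Z = k & f = 'X_[a]).
Arguments graded_piece R {n} S k _.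

(* ------------------------------------------------------------------------ *)

(* S_1 is [both S], T_1 is [both T]. *)
Definition both (n : nat) (A : {set 'I_(n + n)}) : {set 'I_n} :=
  [set i | (lshift n i \in A) && (rshift n i \in A)].

(* x_a with the 1-based numbering a = 1, ..., 2n of the text. *)
Definition xvar (R : realType) (n a : nat) : {mpoly R[i][n + n]} :=
  \sum_(i < n + n | i.+1 == a) 'X_i.

(* {1, ..., m} as a set of indices. *)
Definition initial (n m : nat) : {set 'I_(n + n)} :=
  [set i : 'I_(n + n) | (i.+1 <= m)%N].

(* An index (k, K) consists of k = (k_t)_t and K = (k_{i,j})_{i<j}; the entries
   of K off i < j carry no information and [P_index] sets them to 0. *)
Definition Pidx (n : nat) : eqType :=
  ({ffun 'I_n -> nat} * {ffun 'I_n * 'I_n -> nat})%type.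

(* r_1 + ... + r_n = m forces r_t <= m, so r ranges over 'I_m.+1. *)
Definition Ppoly (R : realType) (n : nat) (p : Pidx n) : {mpoly R[i][n + n]} :=
  let: (k, K) := p in
  let m := (\sum_(t < n) k t)%N./2 in
  \sum_(r : {ffun 'I_n -> 'I_m.+1} | (\sum_(t < n) r t == m)%N)
    ((\sum_(t < n) r t)%N)`!%:R *:
      ((\prod_(t < n) ('C(k t, r t)%:R *:
          ('X_(lshift n t) ^+ (k t - r t) * 'X_(rshift n t) ^+ r t))) *
       \prod_(i < n) \prod_(j < n | (i < j)%N)
         ('X_(lshift n i) * 'X_(rshift n j)
          - 'X_(lshift n j) * 'X_(rshift n i)) ^+ K (i, j)).

(* Admissible indices for which the sum of the k_{i,j} has parity [b]
   (b = true for odd). *)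
Definition P_index (n : nat) (b : bool) (p : Pidx n) : bool :=
  let: (k, K) := p in
  [&& ~~ odd (\sum_(t < n) k t),
      odd (\sum_(i < n) \sum_(j < n | (i < j)%N) K (i, j)) == b,
      [forall i : 'I_n, forall j : 'I_n, (j <= i)%N ==> (K (i, j) == 0%N)],
      [forall i : 'I_n, forall j : 'I_n, forall t : 'I_n,
         (i < j < t)%N ==> (K (i, j) * k t == 0)%N]
    & [forall i : 'I_n, forall j : 'I_n, forall i1 : 'I_n, forall j1 : 'I_n,
         [&& (i < j)%N, (i1 < j1)%N, (i < i1)%N & (j1 < j)%N] ==>
           (K (i, j) * K (i1, j1) == 0)%N]].

(* Main.v *)
Require Import Defs.
From HB Require Import structures.
From mathcomp Require Import all_boot all_order all_algebra.
From mathcomp Require Import perm.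
From mathcomp Require Import boolp reals.
From mathcomp Require Import ring zify.

Set Implicit Arguments.
Unset Strict Implicit.
Unset Printing Implicit Defensive.

Import Order.TTheory GRing.Theory Num.Theory.
Local Open Scope ring_scope.

(** The representation is E_(a,b) = p_a q_b with [q_a, p_b] = delta_(a,b), and with
    q~_a = +- q_(a') (a' the index paired with a) sp(2n) is spanned by the symmetric combinations
    s_(a,b) = p_a q~_b + p_b q~_a.  The antisymmetric ones t_(a,b) span, up to scalars, a complement
    of sp in gl, and [s, t] is in the span of the t's while t t' is in U(sp).  So for an
    sp-submodule W of A_<k>, the sum W + t W is gl-stable, hence all of A_<k>, on which gl acts
    irreducibly.  It remains to see t W in W: D_i = t_(i,i') is diagonal on monomials and D_i t is in
    U(sp); if i is in S_1 or T_1, D_i is definite, so D_i^-1 is a function of D_i^2, which is in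
    U(sp); if S_1 and T_1 are empty, the D_i sum to the scalar k.  When that scalar is 0, the
    exchange of x_i and x_(n+i) commutes with the s's and anticommutes with the t's, so the two
    submodules of A_<0> are its symmetric and antisymmetric parts.

    For the bases, let L be the sum of the x_(n+i) d/dx_i.  Then P_(k,K) = L^m h with 2m the sum of
    the k_t and h the product of the x_t^(k_t) and of the minors to the powers k_(i,j).  All
    polynomials are combinations of the L^r h, and Pluecker relations straighten h.  For independence
    apply L^m with m maximal: this kills the terms with smaller m and turns every x_t of h into
    x_(n+t), after which the leading monomials are distinct. *)

(** * Oscillator operators *)

Lemma sum_indicator (R : nzRingType) (I : finType) (i : I) : \sum_j (j == i)%:R = 1 :> R.
Proof. by rewrite (bigD1 i) //= eqxx big1 ?addr0 // => j /negPf ->. Qed.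

Section Oscillators.
Variables (K : numFieldType) (N : nat) (S : {set 'I_N}).
Implicit Types m : 'X_{1..N}.
Notation A := {mpoly K[N]}.

(** Multiplication and differentiation exchange roles on T, as under a Fourier transform. The sign
    of [osc_q] on T makes the Weyl relation [osc_qp] the same for all indices. *)
Definition osc_p (a : 'I_N) (f : A) : A :=
  if a \in S then 'X_a * f else f^`M(a).
Definition osc_q (a : 'I_N) (f : A) : A :=
  if a \in S then f^`M(a) else - ('X_a * f).

Fact osc_p_is_linear a : linear (osc_p a).
Proof.
move=> c f g; rewrite /osc_p; case: ifP => _; last by rewrite linearP.
by rewrite mulrDr scalerAr.
Qed.
Fact osc_q_is_linear a : linear (osc_q a).
Proof.
move=> c f g; rewrite /osc_q; case: ifP => _; first by rewrite linearP.
by rewrite mulrDr opprD scalerN scalerAr.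
Qed.
HB.instance Definition _ a :=
  GRing.isLinear.Build K A A *:%R (osc_p a) (osc_p_is_linear a).
HB.instance Definition _ a :=
  GRing.isLinear.Build K A A *:%R (osc_q a) (osc_q_is_linear a).

Lemma mderiv_mulX (i j : 'I_N) (f : A) :
  ('X_j * f)^`M(i) = 'X_j * f^`M(i) + (i == j)%:R *: f.
Proof.
rewrite mderivM mderivX mnm1E addrC eq_sym; case: eqP => [->|_].
  suff -> : (U_(j) - U_(j))%MM = 0%MM :> 'X_{1..N} by rewrite mpolyX0 !scale1r mul1r.
  by apply/mnmP => k; rewrite mnmBE mnm0E subnn.
by rewrite !scale0r mul0r.
Qed.

Lemma osc_pC a b f : osc_p a (osc_p b f) = osc_p b (osc_p a f).
Proof.
rewrite /osc_p; case ha: (a \in S); case hb: (b \in S).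
- by rewrite mulrCA.
- by rewrite mderiv_mulX; case: eqP => [e|]; [congruence | rewrite scale0r addr0].
- by rewrite mderiv_mulX; case: eqP => [e|]; [congruence | rewrite scale0r addr0].
- by rewrite mderiv_comm.
Qed.

Lemma osc_qC a b f : osc_q a (osc_q b f) = osc_q b (osc_q a f).
Proof.
rewrite /osc_q; case ha: (a \in S); case hb: (b \in S).
- by rewrite mderiv_comm.
- by rewrite linearN /= mderiv_mulX; case: eqP => [e|];
    [congruence | rewrite scale0r addr0].
- by rewrite linearN /= mderiv_mulX; case: eqP => [e|];
    [congruence | rewrite scale0r addr0].
- by rewrite !mulrN mulrCA.
Qed.

Lemma osc_qp a b f : osc_q a (osc_p b f) = osc_p b (osc_q a f) + (a == b)%:R *: f.
Proof.
rewrite /osc_p /osc_q; case ha: (a \in S); case hb: (b \in S).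
- by rewrite mderiv_mulX.
- case: eqP => [e|_]; first by congruence.
  by rewrite mderiv_comm scale0r addr0.
- case: eqP => [e|_]; first by congruence.
  by rewrite !mulrN mulrCA scale0r addr0.
- rewrite linearN /= mderiv_mulX opprD -addrA [b == a]eq_sym addNr addr0 //.
Qed.

(* The signed degree in x_a, counted so that osc_p raises and osc_q lowers it. *)
Definition osc_wt (a : 'I_N) (m : 'X_{1..N}) : int :=
  if a \in S then (m a)%:Z else - (m a)%:Z.

(** On S this is the Euler operator of x_a. On T it is minus the derivative of x_a f, with
    eigenvalue -(m_a + 1); hence the shift by 1. *)
Lemma osc_pqX a m :
  osc_p a (osc_q a 'X_[m]) = ((osc_wt a m)%:~R - (a \notin S)%:R) *: 'X_[m] :> A.
Proof.
rewrite /osc_p /osc_q /osc_wt; case ha: (a \in S) => /=.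
  rewrite subr0 mderivX -scalerAr -mpolyXD; case: (posnP (m a)) => [->|h].
    by rewrite !scale0r.
  by rewrite addmC submK // lep1mP -lt0n.
rewrite mulrC -mpolyXD linearN /= mderivX mnmDE mnm1E eqxx addmK addn1.
by rewrite -scaleNr -addn1 natrD opprD intrN.
Qed.

(** Raising the signed degree means lowering the exponent when a is in T. Subtraction of exponents
    is truncated, so the lemmas below require a positive exponent in that case. *)
Definition osc_up a (m : 'X_{1..N}) : 'X_{1..N} :=
  if a \in S then (m + U_(a))%MM else (m - U_(a))%MM.
Definition osc_dn a (m : 'X_{1..N}) : 'X_{1..N} :=
  if a \in S then (m - U_(a))%MM else (m + U_(a))%MM.

Lemma osc_pX a m : (a \in S) || (0 < m a)%N ->
  exists2 c : K, c != 0 & osc_p a 'X_[m] = c *: 'X_[osc_up a m].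
Proof.
rewrite /osc_p /osc_up; case: ifP => _ /= h.
  by exists 1; rewrite ?oner_neq0 // scale1r mulrC mpolyXD.
by exists (m a)%:R; rewrite ?mderivX // pnatr_eq0 -lt0n.
Qed.

Lemma osc_qX a m : (a \notin S) || (0 < m a)%N ->
  exists2 c : K, c != 0 & osc_q a 'X_[m] = c *: 'X_[osc_dn a m].
Proof.
rewrite /osc_q /osc_dn; case: ifP => _ /= h.
  by exists (m a)%:R; rewrite ?mderivX // pnatr_eq0 -lt0n.
by exists (-1); rewrite ?oppr_eq0 ?oner_neq0 // scaleN1r mulrC mpolyXD.
Qed.

Lemma osc_wt_up a b m : (a \in S) || (0 < m a)%N ->
  osc_wt b (osc_up a m) = osc_wt b m + (a == b)%:R.
Proof.
rewrite /osc_wt /osc_up; case: (eqVneq a b) => [<-|ne]; case: ifP => ha /= h;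
 case: ifP => hb //=; rewrite ?mnmDE ?mnmBE !mnm1E ?eqxx ?(negPf ne) /=; lia.
Qed.

Lemma osc_wt_dn a b m : (a \notin S) || (0 < m a)%N ->
  osc_wt b (osc_dn a m) = osc_wt b m - (a == b)%:R.
Proof.
rewrite /osc_wt /osc_dn; case: (eqVneq a b) => [<-|ne]; case: ifP => ha /= h;
 case: ifP => hb //=; rewrite ?mnmDE ?mnmBE !mnm1E ?eqxx ?(negPf ne) /=; lia.
Qed.

Lemma osc_wt_inj m m' : (forall a, osc_wt a m = osc_wt a m') -> m = m'.
Proof.
by move=> h; apply/mnmP => a; move: (h a); rewrite /osc_wt; case: ifP => _; lia.
Qed.

Lemma mpolyX_neq0 m : 'X_[m] != 0 :> A.
Proof. by rewrite -msupp_eq0 msuppX. Qed.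

(** The degree k that defines A_<k>. *)
Definition charge (m : 'X_{1..N}) : int := \sum_a osc_wt a m.

End Oscillators.

(** * Subspaces and diagonal operators *)

Section Subspaces.
Variables (K : fieldType) (V : lmodType K) (W : V -> Prop).
Hypothesis subW : is_subspace W.

Lemma subsp0 : W 0. Proof. by case: subW. Qed.
Lemma subspZ c u : W u -> W (c *: u).
Proof. by case: subW => W0 WD Wu; rewrite -[_ *: _]addr0; apply: WD. Qed.
Lemma subspD u v : W u -> W v -> W (u + v).
Proof. by case: subW => W0 WD Wu Wv; rewrite -[u]scale1r; apply: WD. Qed.
Lemma subspB u v : W u -> W v -> W (u - v).
Proof. by move=> Wu Wv; apply: subspD => //; rewrite -scaleN1r; apply: subspZ. Qed.
Lemma subsp_sum (I : Type) (r : seq I) (P : pred I) (F : I -> V) :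
  (forall i, P i -> W (F i)) -> W (\sum_(i <- r | P i) F i).
Proof.
move=> h; elim/big_rec: _ => [|i x Pi Wx]; first exact: subsp0.
by apply: subspD => //; apply: h.
Qed.
Lemma subsp_lspan (P : V -> Prop) v : (forall w, P w -> W w) -> lspan P v -> W v.
Proof.
by move=> h [m [c [w [Pw ->]]]]; apply: subsp_sum => i _; apply/subspZ/h/Pw.
Qed.
End Subspaces.

Lemma lspan_subspace (K : fieldType) (V : lmodType K) (P : V -> Prop) :
  is_subspace (lspan P).
Proof.
split; first by exists 0, (fun=> 0), (fun=> 0); split; [case | rewrite big_ord0].
move=> c u v [m1 [c1 [w1 [P1 ->]]]] [m2 [c2 [w2 [P2 ->]]]].
exists (m1 + m2)%N, (fun i => match split i with inl j => c * c1 j | inr j => c2 j end),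
  (fun i => match split i with inl j => w1 j | inr j => w2 j end); split.
  by move=> i; case: (split i).
rewrite big_split_ord /= scaler_sumr; congr (_ + _); apply: eq_bigr => i _.
  by rewrite (unsplitK (inl i)) scalerA.
by rewrite (unsplitK (inr i)).
Qed.

Lemma lspan_gen (K : fieldType) (V : lmodType K) (P : V -> Prop) v : P v -> lspan P v.
Proof.
by move=> Pv; exists 1, (fun=> 1), (fun=> v); split => //; rewrite big_ord1 scale1r.
Qed.

Section Diagonal.
Variables (K : fieldType) (N : nat).
Notation A := {mpoly K[N]}.
Implicit Types (d g : 'X_{1..N} -> K) (f : A) (W : A -> Prop).

Definition diag_op d f : A := \sum_(m <- msupp f) (d m * f@_m) *: 'X_[m].

Lemma mcoeff_diag d f m : (diag_op d f)@_m = d m * f@_m.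
Proof.
rewrite /diag_op raddf_sum /=.
under eq_bigr do rewrite mcoeffZ mcoeffX.
case: (boolP (m \in msupp f)) => hm.
  rewrite (bigD1_seq m) ?msupp_uniq //= eqxx mulr1 big1 ?addr0 // => i /negPf ->.
  by rewrite mulr0.
rewrite (memN_msupp_eq0 hm) mulr0 big_seq big1 // => i hi; case: eqP => [e|_].
  by rewrite -e hi in hm.
by rewrite mulr0.
Qed.

Lemma linear_diagE (F : {linear A -> A}) d :
  (forall m, F 'X_[m] = d m *: 'X_[m]) -> F =1 diag_op d.
Proof.
move=> h f; rewrite [in LHS](mpolyE f) linear_sum; apply: eq_bigr => m _.
by rewrite linearZ /= h scalerA mulrC.
Qed.

(** Lagrange interpolation with repeated nodes. A new node is met by adding a multiple of Q, which
    vanishes at the earlier nodes; a repeated node needs no change, because g is constant on the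
    fibres of d. *)
Lemma seq_interpolation (T : eqType) (d g : T -> K) (s : seq T) :
  {in s &, forall x y, d x = d y -> g x = g y} ->
  exists P : {poly K}, {in s, forall x, P.[d x] = g x}.
Proof.
elim: s => [|x s IHs] h; first by exists 0.
have [|P hP] := IHs.
  by move=> y z ys zs; apply: h; rewrite inE ?ys ?zs orbT.
case: (boolP (has (fun y => d y == d x) s)) => [/hasP[y ys /eqP e]|/hasPn hn].
  exists P => z; rewrite inE => /predU1P[->|/hP //].
  by rewrite -e hP //; apply: h; rewrite ?inE ?ys ?eqxx ?orbT.
pose Q := \prod_(y <- s) ('X - (d y)%:P).
have Qx : Q.[d x] != 0.
  rewrite /Q horner_prod prodf_seq_neq0; apply/allP => y /hn /=.
  by rewrite hornerXsubC subr_eq0 eq_sym.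
exists (P + ((g x - P.[d x]) / Q.[d x]) *: Q) => z; rewrite inE hornerD hornerZ.
case/predU1P => [->|zs]; first by rewrite divfK // addrC subrK.
have -> : Q.[d z] = 0.
  rewrite /Q horner_prod; apply/eqP; rewrite prodf_seq_eq0; apply/hasP; exists z => //=.
  by rewrite hornerXsubC subrr.
by rewrite mulr0 addr0 hP.
Qed.

(** On the finite support of f the function g is a polynomial in d, so the operator of g acts on f
    as a polynomial in the operator of d. *)
Lemma diag_stable W d g f : is_subspace W ->
  (forall f, W f -> W (diag_op d f)) -> W f ->
  {in msupp f &, forall m m', d m = d m' -> g m = g m'} -> W (diag_op g f).
Proof.
move=> subW Wd Wf /seq_interpolation[P hP].
suff -> : diag_op g f = diag_op (fun m => P.[d m]) f.
  elim/poly_ind: P {hP} => [|P c IHP].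
    suff -> : diag_op (fun m => 0.[d m]) f = 0 by apply: subsp0.
    by apply/mpolyP => m; rewrite mcoeff_diag horner0 mul0r mcoeff0.
  suff -> : diag_op (fun m => (P * 'X + c%:P).[d m]) f =
      c *: f + diag_op d (diag_op (fun m => P.[d m]) f).
    by case: subW => _; apply => //; apply: Wd.
  by apply/mpolyP => m; rewrite mcoeffD mcoeffZ !mcoeff_diag hornerMXaddC; ring.
by rewrite /diag_op big_seq [RHS]big_seq; apply: eq_bigr => m /hP ->.
Qed.

End Diagonal.

(** * Irreducibility under gl *)

Section GlIrreducible.
Variables (K : numFieldType) (N : nat) (S : {set 'I_N}).
Implicit Types m : 'X_{1..N}.
Notation A := {mpoly K[N]}.
Notation p := (@osc_p K N S).
Notation q := (@osc_q K N S).
Variable V : A -> Prop.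
Hypothesis subV : is_subspace V.
Hypothesis stV : forall a b f, V f -> V (p a (q b f)).

(** The operators p_a q_a have a simple joint spectrum on monomials: projecting f onto the exponent
    m_a for one index a after another leaves a multiple of x^m. *)
Lemma gl_stable_monomial f m : V f -> f@_m != 0 -> V 'X_[m].
Proof.
move=> Vf fm.
have H (l : seq 'I_N) :
    V (diag_op (fun m' => (all (fun a => m' a == m a) l)%:R) f).
  elim: l => [|a l IHl] /=.
    suff -> : diag_op (fun=> 1) f = f by [].
    by apply/mpolyP => m'; rewrite mcoeff_diag mul1r.
  set f1 := diag_op _ f in IHl.
  have -> : diag_op (fun m' => ((m' a == m a) && all (fun a => m' a == m a) l)%:R) f
     = diag_op (fun m' => (m' a == m a)%:R) f1.
    by apply/mpolyP => m'; rewrite !mcoeff_diag mulrA -mulnb natrM.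
  apply: (@diag_stable _ _ _
     (fun m => (osc_wt S a m)%:~R - (a \notin S)%:R)) => // [g Vg|m1 m2 _ _].
    rewrite -(@linear_diagE _ _ (p a \o q a : {linear A -> A}) _ (@osc_pqX K N S a)).
    exact: stV.
  move=> /addIr /intr_inj; rewrite /osc_wt; case: ifP => _; last move=> /oppr_inj.
    by case=> ->.
  by case=> ->.
have := subspZ subV (f@_m)^-1 (H (enum 'I_N)).
set g := _ *: _; suff -> : g = 'X_[m] by [].
apply/mpolyP => m'; rewrite mcoeffZ mcoeff_diag mcoeffX.
case: (eqVneq m m') => [<-|ne].
  by rewrite (introT allP) ?mul1r ?mulVf // => a _.
case: allP => [h|_]; last by rewrite mul0r mulr0.
by case/eqP: ne; apply/mnmP => a; apply/esym/eqP/h; rewrite mem_enum.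
Qed.

(** Induction on the distance between the signed degrees. Equal charge makes the differences sum to
    0, so if m and m' differ, some index a has to go up and some b down; p_a q_b does both at
    once. *)
Lemma gl_stable_move m m' : charge S m = charge S m' -> V 'X_[m] -> V 'X_[m'].
Proof.
have [k] := ubnP (\sum_a `|osc_wt S a m - osc_wt S a m'|%N)%N.
elim: k m => // k IHk m lek hc Vm.
have [->//|ne] := eqVneq m' m.
have hs : \sum_a (osc_wt S a m - osc_wt S a m') = 0 by rewrite sumrB -/(charge S m) hc subrr.
have [a ha] : exists a, osc_wt S a m < osc_wt S a m'.
  apply/existsP; apply: contra_neqT ne => /existsPn h.
  apply: (@osc_wt_inj N S) => a; apply/esym/eqP; rewrite -subr_eq0.
  have := @psumr_eq0P _ _ xpredT (fun a => osc_wt S a m - osc_wt S a m').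
  move=> /(_ _ hs a isT) -> // i _.
  by rewrite subr_ge0 leNgt.
have [b hb] : exists b, osc_wt S b m' < osc_wt S b m.
  apply/existsP; apply: contra_neqT ne => /existsPn h.
  apply: (@osc_wt_inj N S) => b; apply/eqP; rewrite -subr_eq0.
  have := @psumr_eq0P _ _ xpredT (fun a => osc_wt S a m' - osc_wt S a m).
  move=> /(_ _ _ b isT) -> //.
    by move=> i _; rewrite subr_ge0 leNgt.
  by rewrite sumrB -/(charge S m) hc subrr.
have ab : a != b by apply: contraTneq ha => ->; rewrite -leNgt ltW.
have qb : (b \notin S) || (0 < m b)%N.
  by move: hb; rewrite /osc_wt; case: ifP => //= _; lia.
have pa : (a \in S) || (0 < osc_dn S b m a)%N.
  have -> : osc_dn S b m a = m a.
    by rewrite /osc_dn; case: ifP => _; rewrite ?mnmBE ?mnmDE mnm1E eq_sym (negPf ab); lia.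
  by move: ha; rewrite /osc_wt; case: ifP => //= _; lia.
set m1 := osc_up S a (osc_dn S b m).
have wt1 i : osc_wt S i m1 = osc_wt S i m - (b == i)%:R + (a == i)%:R.
  by rewrite osc_wt_up // osc_wt_dn.
apply: (IHk m1).
- rewrite -ltnS; apply: leq_trans lek; rewrite ltnS.
  (* The summand at a drops strictly and no other summand grows. *)
  rewrite (bigD1 a) //= [X in (_ < X)%N](bigD1 a) //= -addSn leq_add //.
    by rewrite wt1 eqxx eq_sym (negPf ab) /=; move: ha; lia.
  apply: leq_sum => i ia; rewrite wt1 [a == i]eq_sym (negPf ia) /=.
  by case: eqVneq => [<-|_] /=; move: hb; lia.
- rewrite -hc /charge; under eq_bigr do rewrite wt1.
  rewrite big_split /= sumrB.
  under [X in _ - X]eq_bigr do rewrite eq_sym.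
  under [X in _ + X]eq_bigr do rewrite eq_sym.
  by rewrite !sum_indicator subrK.
have [c c0 ec] := osc_qX K qb; have [c' c'0 ec'] := osc_pX K pa.
have := stV a b Vm; rewrite ec linearZ /= ec' scalerA => /(subspZ subV (c * c')^-1).
by rewrite scalerA mulVf ?mulf_neq0 // scale1r.
Qed.

Lemma gl_stable_full k f g : (forall m, f@_m != 0 -> charge S m = k) -> V f -> f != 0 ->
  (forall m, g@_m != 0 -> charge S m = k) -> V g.
Proof.
move=> fk Vf f0 gk.
have fm : f@_(mlead f) != 0 by rewrite mleadc_eq0.
rewrite [g]mpolyE big_seq; apply: (subsp_sum subV) => m; rewrite mcoeff_msupp => gm.
apply: (subspZ subV); apply: (gl_stable_move _ (gl_stable_monomial Vf fm)).
by rewrite fk ?gk.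
Qed.

End GlIrreducible.

(** * The symplectic operators and their complement in gl *)

Section QuadraticRelations.
Variables (K : numFieldType) (N : nat) (P Q : 'I_N -> {linear {mpoly K[N]} -> {mpoly K[N]}}).
Variable w : 'I_N -> 'I_N -> K.
Hypothesis QP : forall a b f, Q a (P b f) = P b (Q a f) + w a b *: f.
Hypothesis PC : forall a b f, P a (P b f) = P b (P a f).
Hypothesis QC : forall a b f, Q a (Q b f) = Q b (Q a f).
Hypothesis wC : forall a b, w a b = - w b a.
Local Notation s a b f := (P a (Q b f) + P b (Q a f)).
Local Notation t a b f := (P a (Q b f) - P b (Q a f) - w a b *: f).

(** Normal ordering: [QP] moves every Q to the right of every P, and the commutation rules sort the
    indices. What is left is a commutative identity between the vectors P P Q Q f, P Q f and f,
    taken as atoms. *)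
Lemma antisym_quadratic_mul a b c d f :
  t a b (t c d f) =
    s a d (s b c f) - s a c (s b d f) + w c d *: s a b f
    - w a c *: s b d f + w a d *: s b c f + (w a b * w c d) *: f.
Proof.
rewrite !(linearD, linearB, linearN, linearZ) /= !QP.
rewrite !(linearD, linearB, linearN, linearZ) /=.
rewrite ?(wC c a) ?(wC d a) ?(wC c b) ?(wC d b) ?(wC d c) ?(wC b a).
rewrite ?(PC c a) ?(PC c b) ?(PC d a) ?(PC d b) ?(PC d c) ?(PC b a).
rewrite ?(QC c a) ?(QC c b) ?(QC d a) ?(QC d b) ?(QC d c) ?(QC b a).
rewrite -!mul_mpolyC !(mpolyCN, mpolyCM).
ring.
Qed.

Lemma sym_antisym_quadratic a b c d f :
  s a b (t c d f) = t c d (s a b f)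
    + w b c *: t a d f + w a c *: t b d f
    + w a d *: t c b f + w b d *: t c a f.
Proof.
rewrite !(linearD, linearB, linearN, linearZ) /= !QP.
rewrite !(linearD, linearB, linearN, linearZ) /=.
rewrite ?(wC c a) ?(wC d a) ?(wC c b) ?(wC d b) ?(wC d c) ?(wC b a).
rewrite ?(PC c a) ?(PC c b) ?(PC d a) ?(PC d b) ?(PC d c) ?(PC b a).
rewrite ?(QC c a) ?(QC c b) ?(QC d a) ?(QC d b) ?(QC d c) ?(QC b a).
rewrite -!mul_mpolyC !(mpolyCN, mpolyCM).
ring.
Qed.
End QuadraticRelations.

Section Symplectic.
Variables (K : numFieldType) (n : nat) (S : {set 'I_(n + n)}).
Notation A := {mpoly K[n + n]}.
Notation p := (@osc_p K _ S).
Notation q := (@osc_q K _ S).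
Implicit Types (a b c d : 'I_(n + n)) (f : A) (i j : 'I_n).

Definition bar a := match split a with inl i => rshift n i | inr i => lshift n i end.
Definition bar_sign a : K := match split a with inl _ => -1 | inr _ => 1 end.

Lemma bar_lshift i : bar (lshift n i) = rshift n i.
Proof. by rewrite /bar (unsplitK (inl i)). Qed.
Lemma bar_rshift i : bar (rshift n i) = lshift n i.
Proof. by rewrite /bar (unsplitK (inr i)). Qed.
Lemma bar_sign_lshift i : bar_sign (lshift n i) = -1.
Proof. by rewrite /bar_sign (unsplitK (inl i)). Qed.
Lemma bar_sign_rshift i : bar_sign (rshift n i) = 1.
Proof. by rewrite /bar_sign (unsplitK (inr i)). Qed.

Lemma barP (P : 'I_(n + n) -> Prop) :
  (forall i, P (lshift n i)) -> (forall i, P (rshift n i)) -> forall a, P a.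
Proof. by move=> Pl Pr a; rewrite -(splitK a); case: (split a). Qed.

Lemma barK : involutive bar.
Proof. by elim/barP => i; rewrite ?(bar_lshift, bar_rshift). Qed.
Lemma bar_sign_bar a : bar_sign (bar a) = - bar_sign a.
Proof.
by elim/barP: a => i; rewrite ?(bar_lshift, bar_rshift) bar_sign_lshift bar_sign_rshift ?opprK.
Qed.
Lemma bar_signK a f : bar_sign a *: (bar_sign a *: f) = f.
Proof.
by elim/barP: a => i; rewrite scalerA ?bar_sign_lshift ?bar_sign_rshift ?mulrNN mulr1 scale1r.
Qed.
Lemma bar_eq a b : (bar a == b) = (a == bar b).
Proof. by rewrite (can2_eq barK barK). Qed.

(** The matrix of the symplectic form, which is the commutator of q~_a with p_b ([sp_qp]). *)
Definition omega a b : K := bar_sign a * (bar a == b)%:R.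

Lemma omegaC a b : omega a b = - omega b a.
Proof.
rewrite /omega bar_eq eq_sym; case: eqP => [<-|_]; last by rewrite !mulr0 oppr0.
by rewrite bar_sign_bar mulNr.
Qed.

Definition sp_q a f := bar_sign a *: q (bar a) f.
Fact sp_q_is_linear a : linear (sp_q a).
Proof. by move=> c f g; rewrite /sp_q linearP scalerDr !scalerA mulrC. Qed.
HB.instance Definition _ a := GRing.isLinear.Build K A A *:%R (sp_q a) (sp_q_is_linear a).

Lemma sp_qp a b f : sp_q a (p b f) = p b (sp_q a f) + omega a b *: f.
Proof. by rewrite /sp_q osc_qp scalerDr scalerA [in RHS]linearZ. Qed.
Lemma sp_qC a b f : sp_q a (sp_q b f) = sp_q b (sp_q a f).
Proof. by rewrite /sp_q !linearZ /= osc_qC !scalerA mulrC. Qed.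

Definition sp_s a b f := p a (sp_q b f) + p b (sp_q a f).
(** The scalar is the Weyl ordering correction: t_(a,b) is p_a q~_b - p_b q~_a with each product
    replaced by half the sum over its two orders. This is what makes the swap below change its sign
    exactly. *)
Definition sp_t a b f := p a (sp_q b f) - p b (sp_q a f) - omega a b *: f.

Fact sp_s_is_linear a b : linear (sp_s a b).
Proof. by move=> c f g; rewrite /sp_s !linearP scalerDr addrACA. Qed.
Fact sp_t_is_linear a b : linear (sp_t a b).
Proof.
move=> c f g; rewrite /sp_t !linearP /= -!mul_mpolyC.
by ring.
Qed.
HB.instance Definition _ a b :=
  GRing.isLinear.Build K A A *:%R (sp_s a b) (sp_s_is_linear a b).
HB.instance Definition _ a b :=
  GRing.isLinear.Build K A A *:%R (sp_t a b) (sp_t_is_linear a b).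

Lemma osc_p_sp_q a b f :
  p a (sp_q b f) = 2%:R^-1 *: (sp_s a b f + sp_t a b f + omega a b *: f).
Proof.
rewrite /sp_s /sp_t; set x := p a _; set y := p b _; set z := _ *: f.
have -> : x + y + (x - y - z) + z = 2%:R *: x by rewrite -mul_mpolyC mpolyC_nat; ring.
by rewrite scalerA mulVf ?scale1r // pnatr_eq0.
Qed.

(* In gl = sp + Lambda^2, products of two elements of Lambda^2 act as elements of U(sp). *)
Lemma sp_t_mul a b c d f :
  sp_t a b (sp_t c d f) =
    sp_s a d (sp_s b c f) - sp_s a c (sp_s b d f) + omega c d *: sp_s a b f
    - omega a c *: sp_s b d f + omega a d *: sp_s b c f + (omega a b * omega c d) *: f.
Proof.
exact: (@antisym_quadratic_mul _ _ (fun a => p a : {linear A -> A})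
  (fun a => sp_q a : {linear A -> A}) omega sp_qp (@osc_pC _ _ S) sp_qC omegaC).
Qed.

(** Lambda^2 is a module under the adjoint action of sp, so moving s past t costs only further
    t's. *)
Lemma sp_s_t a b c d f :
  sp_s a b (sp_t c d f) = sp_t c d (sp_s a b f)
    + omega b c *: sp_t a d f + omega a c *: sp_t b d f
    + omega a d *: sp_t c b f + omega b d *: sp_t c a f.
Proof.
exact: (@sym_antisym_quadratic _ _ (fun a => p a : {linear A -> A})
  (fun a => sp_q a : {linear A -> A}) omega sp_qp (@osc_pC _ _ S) sp_qC omegaC).
Qed.
End Symplectic.

(** * The charge as a gl-invariant *)

Section Charge.
Variables (K : numFieldType) (N : nat) (S : {set 'I_N}).
Notation A := {mpoly K[N]}.
Notation p := (@osc_p K N S).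
Notation q := (@osc_q K N S).

Definition has_charge (k : int) (f : A) : Prop := forall m, f@_m != 0 -> charge S m = k.

Definition charge_op : A -> A := diag_op (fun m => (charge S m)%:~R).

Lemma has_chargeP k f : has_charge k f <-> charge_op f = k%:~R *: f.
Proof.
split=> [h|h m fm].
  apply/mpolyP => m; rewrite mcoeff_diag mcoeffZ.
  by case: (eqVneq f@_m 0) => [->|/h ->]; rewrite ?mulr0.
move/mpolyP: h => /(_ m); rewrite mcoeff_diag mcoeffZ => /(mulIf fm) /intr_inj //.
Qed.

(** Each index of T contributes a shift of -1 to the eigenvalues of p_a q_a, which the number of
    elements of T compensates. *)
Lemma charge_opE f : charge_op f = \sum_a p a (q a f) + #|~: S|%:R *: f.
Proof.
pose d a m : K := (osc_wt S a m)%:~R - (a \notin S)%:R.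
have E a : p a (q a f) = diag_op (d a) f.
  exact: (@linear_diagE _ _ (p a \o q a : {linear A -> A}) _ (@osc_pqX K N S a)).
apply/mpolyP => m; rewrite /charge_op mcoeffD mcoeffZ [in RHS]raddf_sum /= mcoeff_diag.
under [in RHS]eq_bigr do rewrite E mcoeff_diag.
rewrite -mulr_suml -mulrDl sumrB rmorph_sum /= -sum1_card natr_sum.
rewrite [X in _ - X + _](eq_bigr (fun a => if a \in ~: S then 1 else 0)) ?subrK //.
  by rewrite -big_mkcond /= subrK.
by move=> a _; rewrite inE; case: ifP.
Qed.

(** The sum of all p_c q_c commutes with p_a q_b: the commutators coming from c = a and from c = b
    cancel. *)
Lemma has_charge_pq k a b f : has_charge k f -> has_charge k (p a (q b f)).
Proof.
move=> /has_chargeP h; apply/has_chargeP; move: h; rewrite !charge_opE.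
have -> : \sum_c p c (q c (p a (q b f))) = p a (q b (\sum_c p c (q c f))).
  have E c : p c (q c (p a (q b f))) =
      p a (q b (p c (q c f))) + (c == a)%:R *: p a (q b f) - (b == c)%:R *: p a (q b f).
    rewrite osc_qp linearD linearZ /= osc_pC osc_qC osc_qp linearD linearZ /=.
    rewrite -!mul_mpolyC; case: eqVneq => [->|_]; case: eqVneq => [->|_];
    rewrite ?mpolyC0 ?mpolyC1; ring.
  rewrite (eq_bigr _ (fun c _ => E c)) !big_split /= sumrN -!scaler_suml.
  under [X in _ - X *: _]eq_bigr do rewrite eq_sym.
  by rewrite !sum_indicator addrK !linear_sum.
by move=> e; rewrite -!linearZ -!linearD /= e !linearZ.
Qed.

Lemma has_charge_subspace k : is_subspace (has_charge k).
Proof.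
split=> [m|c u v hu hv m]; first by rewrite mcoeff0 eqxx.
rewrite mcoeffD mcoeffZ; case: (eqVneq u@_m 0) => [->|/hu //].
by rewrite mulr0 add0r => /hv.
Qed.

Lemma has_chargeX m : has_charge (charge S m) 'X_[m].
Proof. by move=> m'; rewrite mcoeffX; case: (eqVneq m m') => [->|_] //; rewrite eqxx. Qed.

Lemma has_charge1 : has_charge 0 1.
Proof.
rewrite -mpolyX0 -[X in has_charge X](_ : charge S 0%MM = 0); first exact: has_chargeX.
by rewrite /charge big1 // => a _; rewrite /osc_wt mnm0E oppr0 if_same.
Qed.

End Charge.

(** * Submodules *)

Section SpSubmodules.
Variables (K : numFieldType) (n : nat) (S : {set 'I_(n + n)}).
Notation A := {mpoly K[n + n]}.
Notation p := (@osc_p K _ S).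
Notation q := (@osc_q K _ S).
Notation s := (@sp_s K n S).
Notation t := (@sp_t K n S).
Notation has_charge := (@has_charge K (n + n) S).

Lemma osc_q_sp_q b f : q b f = bar_sign K (bar b) *: @sp_q K n S (bar b) f.
Proof. by rewrite /sp_q bar_signK barK. Qed.

Section Stable.
Variable W : A -> Prop.
Hypothesis subW : is_subspace W.
Hypothesis sW : forall a b f, W f -> W (s a b f).

Definition t_span : A -> Prop := lspan (fun g => exists a b w, W w /\ g = t a b w).

Lemma sp_t_t a b c d f : W f -> W (t a b (t c d f)).
Proof.
move=> Wf; rewrite sp_t_mul.
by repeat first [exact: Wf | exact: subW | apply: sW | apply: subspB | apply: subspD |
  apply: subspZ].
Qed.

(** The sum W + t W, the gl-module generated by the sp-module W. *)
Definition sp_closure f : Prop := exists2 u, t_span u & W (f - u).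

Lemma sp_closure_subspace : is_subspace sp_closure.
Proof.
split; first by exists 0; [exact: (lspan_subspace _).1 | rewrite subr0; case: subW].
move=> c f g [u tu Wu] [v tv Wv]; exists (c *: u + v).
  by apply: (lspan_subspace _).2.
rewrite opprD addrACA -scalerBr; exact: (subW.2).
Qed.

Lemma sp_closure_W f : W f -> sp_closure f.
Proof.
move=> Wf; exists 0; last by rewrite subr0.
exact: (lspan_subspace _).1.
Qed.

(** The operator t exchanges the two summands: it sends W into t W by definition, and t W back into
    W by [sp_t_t]. *)
Lemma sp_closure_t a b f : sp_closure f -> sp_closure (t a b f).
Proof.
move=> [u tu Wu]; exists (t a b (f - u)).
  by apply: lspan_gen; exists a, b, (f - u).
rewrite -linearB opprB addrC subrK.
apply: (@subsp_lspan _ _ (fun u => W (t a b u)) _ _ _ _ tu) => [|g [c [d [w [Ww ->]]]]].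
  split=> [|c x y Wx Wy]; first by rewrite linear0; case: subW.
  by rewrite linearP; apply: subW.2.
exact: sp_t_t.
Qed.

Lemma sp_closure_s a b f : sp_closure f -> sp_closure (s a b f).
Proof.
move=> [u tu Wu]; exists (s a b u); last by rewrite -linearB; apply: sW.
apply: (@subsp_lspan _ _ (fun u => t_span (s a b u)) _ _ _ _ tu) => [|g [c [d [w [Ww ->]]]]].
  split=> [|c x y Wx Wy]; first by rewrite linear0; apply: (lspan_subspace _).1.
  by rewrite linearP; apply: (lspan_subspace _).2.
have G c' d' w' : W w' -> t_span (t c' d' w').
  by move=> ?; apply: lspan_gen; exists c', d', w'.
rewrite sp_s_t.
by repeat first [exact: Ww | apply: sW | apply: G | apply: (subspD (lspan_subspace _)) |
  apply: (subspZ (lspan_subspace _))].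
Qed.

(** Every p_a q_b is a combination of an s, a t and a scalar, so W + t W is stable under gl and
    [gl_stable_full] applies. *)
Lemma sp_closure_full k f g : W f -> f != 0 -> has_charge k f -> has_charge k g ->
  sp_closure g.
Proof.
move=> Wf f0 fk gk.
apply: (@gl_stable_full K _ S sp_closure sp_closure_subspace _ k f) => //; last exact: sp_closure_W.
move=> a b h Vh; rewrite osc_q_sp_q linearZ /= osc_p_sp_q.
have ? := sp_closure_subspace.
by repeat first [assumption | apply: sp_closure_s | apply: sp_closure_t | apply: subspD |
  apply: subspZ].
Qed.

Lemma sp_t_stable_full k f g : (forall a b f, W f -> has_charge k f -> W (t a b f)) ->
  (forall f, W f -> has_charge k f) ->
  W f -> f != 0 -> has_charge k g -> W g.
Proof.
move=> tW Wk Wf f0 gk.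
have [u tu Wu] := sp_closure_full Wf f0 (Wk _ Wf) gk.
rewrite -[g](subrK u); apply: subspD => //.
apply: (subsp_lspan subW) tu => _ [a [b [w [Ww ->]]]].
by apply: tW => //; apply: Wk.
Qed.

End Stable.
End SpSubmodules.

(** * Stability under the complement of sp *)

Section TStable.
Variables (K : numFieldType) (n : nat) (S : {set 'I_(n + n)}).
Notation A := {mpoly K[n + n]}.
Notation p := (@osc_p K _ S).
Notation q := (@osc_q K _ S).
Notation s := (@sp_s K n S).
Notation t := (@sp_t K n S).
Notation has_charge := (@has_charge K (n + n) S).

(** The eigenvalue of D_i = t_(i,i') on x^m, see [sp_t_pairE]. *)
Definition pair_wt (i : 'I_n) (m : 'X_{1..n + n}) : int :=
  osc_wt S (lshift n i) m - (lshift n i \notin S)%:R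
  + (osc_wt S (rshift n i) m - (rshift n i \notin S)%:R) + 1.

Lemma sp_t_pair i f : t (lshift n i) (rshift n i) f
  = p (lshift n i) (q (lshift n i) f) + p (rshift n i) (q (rshift n i) f) + f.
Proof.
rewrite /sp_t /sp_q /omega !bar_rshift !bar_lshift bar_sign_lshift bar_sign_rshift eqxx.
by rewrite scale1r mulr1 !scaleN1r linearN !opprK.
Qed.

Lemma sp_t_pairE i f :
  t (lshift n i) (rshift n i) f = diag_op (fun m => (pair_wt i m)%:~R) f.
Proof.
rewrite -(@linear_diagE _ _ (t (lshift n i) (rshift n i) : {linear A -> A})) // => m.
rewrite [LHS]sp_t_pair !osc_pqX -scalerDl -[X in _ + X]scale1r -scalerDl.
by congr (_ *: _); rewrite /pair_wt !(rmorphD, rmorphN) /= !rmorph_nat rmorph1.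
Qed.

Lemma has_charge_sp_t k a b f : has_charge k f -> has_charge k (t a b f).
Proof.
move=> h; have subC := @has_charge_subspace K _ S k.
have E c d : has_charge k (p c (sp_q S d f)).
  by rewrite /sp_q linearZ /=; apply: (subspZ subC); apply: has_charge_pq.
rewrite /sp_t; apply: (subspB subC); last by apply: (subspZ subC).
by apply: (subspB subC).
Qed.

Variable W : A -> Prop.
Hypothesis subW : is_subspace W.
Hypothesis sW : forall a b f, W f -> W (s a b f).

(** For i in S_1 the value is m_i + m_(n+i) + 1, and for i in T_1 it is the negative of that
    number. *)
Lemma pair_wt_eq0F i m :
  (lshift n i \in S) = (rshift n i \in S) -> pair_wt i m != 0.
Proof. by rewrite /pair_wt /osc_wt => ->; case: ifP => _ /=; lia. Qed.

Lemma pair_wt_sqr_inj i m m' : (lshift n i \in S) = (rshift n i \in S) ->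
  pair_wt i m ^+ 2 = pair_wt i m' ^+ 2 -> pair_wt i m = pair_wt i m'.
Proof.
rewrite /pair_wt /osc_wt => -> /eqP; rewrite eqf_sqr => /orP[/eqP//|/eqP].
by case: ifP => _ /=; lia.
Qed.

(* The square of D = t_{i,i'} acts in U(sp), and D has constant sign on monomials. *)
Lemma sp_t_stable_definite i : (lshift n i \in S) = (rshift n i \in S) ->
  forall a b f, W f -> W (t a b f).
Proof.
move=> hi a b f Wf.
pose d m : K := (pair_wt i m)%:~R.
have d0 m : d m != 0 by rewrite intr_eq0 pair_wt_eq0F.
suff -> : t a b f = diag_op (fun m => (d m)^-1) (diag_op d (t a b f)).
  (* The sign of d does not depend on the monomial, so d^2 determines d and hence its inverse. *)
  apply: (@diag_stable _ _ _ (fun m => d m ^+ 2)) => // [g Wg||m m' _ _].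
  - have -> : diag_op (fun m => d m ^+ 2) g =
        t (lshift n i) (rshift n i) (t (lshift n i) (rshift n i) g).
      rewrite !sp_t_pairE; apply/mpolyP => m; rewrite !mcoeff_diag; ring.
    exact: sp_t_t.
  - by rewrite -sp_t_pairE; apply: sp_t_t.
  - by rewrite /d -!rmorphXn /= => /intr_inj /(pair_wt_sqr_inj hi) ->.
by apply/mpolyP => m; rewrite !mcoeff_diag mulKf.
Qed.

Hypothesis leftT : forall i, lshift n i \notin S.
Hypothesis rightS : forall i, rshift n i \in S.

Lemma sum_pair_wt m : \sum_i pair_wt i m = charge S m.
Proof.
rewrite /charge big_split_ord /= -big_split /=; apply: eq_bigr => i _.
(* The shift -1 coming from i in T cancels the constant +1 of [pair_wt]. *)
by rewrite /pair_wt leftT rightS /=; lia.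
Qed.

Lemma sp_t_stable_charge k : k != 0 ->
  forall a b f, W f -> has_charge k f -> W (t a b f).
Proof.
move=> k0 a b f Wf fk.
suff -> : t a b f = k%:~R^-1 *: \sum_i t (lshift n i) (rshift n i) (t a b f).
  by apply: subspZ => //; apply: subsp_sum => // i _; apply: sp_t_t.
apply/mpolyP => m; rewrite mcoeffZ raddf_sum /=.
under eq_bigr do rewrite sp_t_pairE mcoeff_diag.
rewrite -mulr_suml -rmorph_sum /= sum_pair_wt.
have := @has_charge_sp_t k a b f fk m; case: (eqVneq (t a b f)@_m 0) => [->|_ ->] //.
  by rewrite !mulr0.
by rewrite mulKf // intr_eq0.
Qed.

End TStable.

(** * The symmetry exchanging x_i and x_(n+i) *)

Section Swap.
Variables (K : numFieldType) (n : nat) (S : {set 'I_(n + n)}).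
Notation A := {mpoly K[n + n]}.
Notation p := (@osc_p K _ S).
Notation q := (@osc_q K _ S).
Notation s := (@sp_s K n S).
Notation t := (@sp_t K n S).
Notation has_charge := (@has_charge K (n + n) S).

Definition swap_op : A -> A := msym (perm (inv_inj (@barK n))).
HB.instance Definition _ := GRing.Linear.on swap_op.

Lemma mcoeff_swap f m : (swap_op f)@_m = f@_[multinom m (bar i) | i < n + n].
Proof. by rewrite mcoeff_sym; congr (_@__); apply/mnmP => i; rewrite !mnmE permE. Qed.

Lemma swap_opK : involutive swap_op.
Proof.
move=> f; apply/mpolyP => m; rewrite !mcoeff_swap; congr (_@__).
by apply/mnmP => i; rewrite !mnmE barK.
Qed.

Lemma swap_opM f g : swap_op (f * g) = swap_op f * swap_op g.
Proof. exact: msymM. Qed.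

Lemma swap_opX a : swap_op 'X_a = 'X_(bar a).
Proof.
rewrite /swap_op msymX; congr 'X_[_]; apply/mnmP => i; rewrite !mnmE.
congr nat_of_bool; apply/eqP/eqP => [->|<-].
  by rewrite -[bar _](permE (inv_inj (@barK n))) permKV.
by rewrite -(permE (inv_inj (@barK n))) permK.
Qed.

Lemma swap_op_deriv a f : swap_op f^`M(a) = (swap_op f)^`M(bar a).
Proof.
apply/mpolyP => m; rewrite mcoeff_swap !mcoeff_deriv mcoeff_swap mnmE; congr (_@__ *+ _).
by apply/mnmP => i; rewrite !(mnmE, mnmDE) -(inj_eq (inv_inj (@barK n))).
Qed.

Hypothesis leftT : forall i, lshift n i \notin S.
Hypothesis rightS : forall i, rshift n i \in S.

(** Exactly one of a and [bar a] is in S, so p_a and q_(bar a) are of the same kind, both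
    multiplications or both derivatives up to sign. The swap therefore exchanges p_a with -q~_a. *)
Lemma swap_osc_p a f : swap_op (p a f) = - sp_q S a (swap_op f).
Proof.
elim/barP: a => i; rewrite /sp_q /osc_p /osc_q ?bar_lshift ?bar_rshift ?rightS
  ?(negPf (leftT _)).
  by rewrite swap_op_deriv bar_lshift bar_sign_lshift scaleN1r opprK.
by rewrite swap_opM swap_opX bar_rshift bar_sign_rshift scale1r opprK.
Qed.

Lemma swap_sp_q a f : swap_op (sp_q S a f) = - p a (swap_op f).
Proof. by rewrite -{1}[f]swap_opK -[sp_q _ _ _]opprK -swap_osc_p linearN /= swap_opK. Qed.

Lemma swap_pq a b f : swap_op (p a (sp_q S b f))
  = p b (sp_q S a (swap_op f)) + omega K a b *: swap_op f.
Proof. by rewrite [LHS]swap_osc_p swap_sp_q [sp_q _ _ (- _)]linearN opprK [LHS]sp_qp. Qed.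

Lemma swap_sp_s a b f : swap_op (s a b f) = s a b (swap_op f).
Proof.
rewrite [LHS]linearD /= !swap_pq [omega K b a]omegaC scaleNr addrACA subrr addr0.
exact: addrC.
Qed.

Lemma swap_sp_t a b f : swap_op (t a b f) = - t a b (swap_op f).
Proof.
rewrite [LHS]linearB /= [swap_op (_ - _)]linearB /= !swap_pq.
rewrite [swap_op (_ *: f)]linearZ /= [omega K b a]omegaC scaleNr /sp_t.
move: (p a _) (p b _) (omega _ _ _ *: _) => x y z.
by ring.
Qed.

Lemma charge_swap (m : 'X_{1..n + n}) : charge S [multinom m (bar i) | i < n + n] = - charge S m.
Proof.
rewrite /charge !big_split_ord /= opprD [RHS]addrC -!sumrN.
by congr (_ + _); apply: eq_bigr => i _; rewrite /osc_wt mnmE ?bar_lshift ?bar_rshift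
  ?rightS ?(negPf (leftT _)) ?opprK.
Qed.

(** The symmetric part of A_<0> for [e = false], the antisymmetric one for [e = true]; the same
    convention as the parity in [P_index]. *)
Definition charge0_part (e : bool) f := has_charge 0 f /\ swap_op f = (-1) ^+ e *: f.

Lemma charge0_part_subspace e : is_subspace (charge0_part e).
Proof.
split; first by split; [exact: (has_charge_subspace _ _ _).1 | rewrite linear0 scaler0].
move=> c f g [f0 fe] [g0 ge]; split; first exact: (has_charge_subspace _ _ _).2.
by rewrite linearP /= fe ge scalerDr !scalerA mulrC.
Qed.

Lemma has_charge_sp_s k a b f : has_charge k f -> has_charge k (s a b f).
Proof.
move=> h; have subC := @has_charge_subspace K _ S k.
have E c d : has_charge k (p c (sp_q S d f)).
  by rewrite /sp_q linearZ /=; apply: (subspZ subC); apply: has_charge_pq.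
by apply: (subspD subC).
Qed.

Lemma charge0_part_sp_s e a b f : charge0_part e f -> charge0_part e (s a b f).
Proof. by case=> f0 fe; split; [exact: has_charge_sp_s | rewrite swap_sp_s fe linearZ]. Qed.

Lemma charge0_part_sp_t e a b f : charge0_part e f -> charge0_part (~~ e) (t a b f).
Proof.
case=> f0 fe; split; first exact: has_charge_sp_t.
by rewrite swap_sp_t fe linearZ /=; case: e {fe}; rewrite ?scale1r ?scaleN1r ?opprK.
Qed.

Lemma charge0_part_disjoint e f : charge0_part e f -> charge0_part (~~ e) f -> f = 0.
Proof.
case=> _ fe [_]; rewrite fe => /eqP; rewrite -subr_eq0 -scalerBl scaler_eq0.
have two : 1 + 1 != 0 :> K by rewrite (_ : 1 + 1 = 2%:R) ?pnatr_eq0.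
by case/orP => [|/eqP //]; case: (e); rewrite /= ?expr0 ?expr1 -?opprD ?opprK ?oppr_eq0 (negPf two).
Qed.

Lemma charge0_part_decomp f : has_charge 0 f -> exists u1 u2,
  [/\ charge0_part false u1, charge0_part true u2 & f = u1 + u2].
Proof.
move=> f0; have sub0 := has_charge_subspace K S 0.
have s0 : has_charge 0 (swap_op f).
  move=> m; rewrite mcoeff_swap => /f0; rewrite charge_swap => /eqP.
  by rewrite oppr_eq0 => /eqP.
exists (2%:R^-1 *: (f + swap_op f)), (2%:R^-1 *: (f - swap_op f)); split.
- split; first exact: (subspZ sub0) (subspD sub0 _ _).
  by rewrite linearZ linearD /= swap_opK addrC expr0 scale1r.
- split; first exact: (subspZ sub0) (subspB sub0 _ _).
  by rewrite linearZ linearB /= swap_opK expr1 scaleN1r -scalerN opprB.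
rewrite -scalerDr addrACA subrr addr0 -mulr2n -scaler_nat scalerA mulVf ?scale1r //.
by rewrite pnatr_eq0.
Qed.

Variable W : A -> Prop.
Hypothesis subW : is_subspace W.
Hypothesis sW : forall a b f, W f -> W (s a b f).

(** Write g = w + u with w in W and u in t W. Then u has the parity opposite to e because t reverses
    parity, and the parity e because u = g - w; so u = 0. *)
Lemma charge0_part_irreducible e f g : (forall h, W h -> charge0_part e h) ->
  W f -> f != 0 -> charge0_part e g -> W g.
Proof.
move=> We Wf f0 [g0 ge].
have [u tu Wu] := sp_closure_full subW sW Wf f0 (We _ Wf).1 g0.
suff -> : g = g - u by [].
suff -> : u = 0 by rewrite subr0.
apply: (@charge0_part_disjoint e).
  rewrite -[u](subKr g); apply: (subspB (charge0_part_subspace e)) => //; exact: We.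
apply: (subsp_lspan (charge0_part_subspace _)) tu => _ [a [b [w [Ww ->]]]].
by apply: charge0_part_sp_t; apply: We.
Qed.
End Swap.

(** * The representation of sp(2n) *)

Section Representation.
Variables (R : realType) (n : nat) (S : {set 'I_(n + n)}).
Notation K := R[i].
Notation A := {mpoly K[n + n]}.
Notation p := (@osc_p K _ S).
Notation q := (@osc_q K _ S).
Notation s := (@sp_s K n S).
Notation t := (@sp_t K n S).
Implicit Types (i j : 'I_n) (m : 'X_{1..n + n}) (f g : A) (M : 'M[K]_(n + n)) (W : A -> Prop).

Lemma gl_unit_actE a b f : gl_unit_act S a b f = p a (q b f).
Proof.
rewrite /gl_unit_act /osc_p /osc_q; case: (a \in S); case: (b \in S) => //.
  by rewrite mulrN mulrA.
by rewrite linearN /= mderiv_mulX opprD.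
Qed.

Fact gl_act_is_linear M : linear (gl_act S M).
Proof.
move=> c f g; rewrite /gl_act scaler_sumr -big_split /=; apply: eq_bigr => i _.
rewrite scaler_sumr -big_split /=; apply: eq_bigr => j _.
by rewrite !gl_unit_actE !linearP /= !scalerA mulrC.
Qed.
HB.instance Definition _ M := GRing.isLinear.Build K A A *:%R (gl_act S M) (gl_act_is_linear M).

Lemma gl_act_linearl c M M' f : gl_act S (c *: M + M') f = c *: gl_act S M f + gl_act S M' f.
Proof.
rewrite /gl_act scaler_sumr -big_split /=; apply: eq_bigr => i _.
rewrite scaler_sumr -big_split /=; apply: eq_bigr => j _.
by rewrite !mxE scalerDl scalerA.
Qed.

Lemma gl_act_delta a b f : gl_act S (delta_mx a b) f = p a (q b f).
Proof.
rewrite -gl_unit_actE /gl_act; move: (@gl_unit_act R n S) => g.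
rewrite (bigD1 a) //= (bigD1 b) //= mxE !eqxx scale1r.
rewrite !big1 ?addr0 // => [i /negPf ia | j /negPf jb]; last by rewrite mxE jb andbF scale0r.
by rewrite big1 // => j _; rewrite mxE ia scale0r.
Qed.

Lemma gl_actD M M' f : gl_act S (M + M') f = gl_act S M f + gl_act S M' f.
Proof. by have := gl_act_linearl 1 M M' f; rewrite !scale1r. Qed.
Lemma gl_actB M M' f : gl_act S (M - M') f = gl_act S M f - gl_act S M' f.
Proof. by rewrite addrC -scaleN1r gl_act_linearl scaleN1r addrC. Qed.

Lemma gl_act0 f : gl_act S 0 f = 0.
Proof. by rewrite -(subrr (0 : 'M_(n + n))) gl_actB subrr. Qed.

Lemma gl_act_lspan (P : 'M[K]_(n + n) -> Prop) W f M :
  is_subspace W -> (forall M, P M -> W (gl_act S M f)) -> lspan P M -> W (gl_act S M f).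
Proof.
move=> subW h; apply: (@subsp_lspan _ _ (fun M => W (gl_act S M f))) => //.
split=> [|c M1 M2 W1 W2]; first by rewrite gl_act0; apply: subsp0.
by rewrite gl_act_linearl; apply: subW.2.
Qed.

Lemma sp_s_sym a b f : s a b f = s b a f.
Proof. exact: addrC. Qed.

Lemma sp_s_lr i j f : s (lshift n i) (rshift n j) f =
  gl_act S (delta_mx (lshift n i) (lshift n j) - delta_mx (rshift n j) (rshift n i)) f.
Proof.
rewrite gl_actB !gl_act_delta /sp_s /sp_q bar_lshift bar_rshift bar_sign_lshift bar_sign_rshift.
by rewrite scale1r scaleN1r linearN.
Qed.
Lemma sp_s_rr i j f : s (rshift n i) (rshift n j) f =
  gl_act S (delta_mx (rshift n i) (lshift n j) + delta_mx (rshift n j) (lshift n i)) f.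
Proof.
by rewrite gl_actD !gl_act_delta /sp_s /sp_q !bar_rshift !bar_sign_rshift !scale1r.
Qed.
Lemma sp_s_ll i j f : s (lshift n i) (lshift n j) f =
  - gl_act S (delta_mx (lshift n i) (rshift n j) + delta_mx (lshift n j) (rshift n i)) f.
Proof.
rewrite gl_actD !gl_act_delta /sp_s /sp_q !bar_lshift !bar_sign_lshift !scaleN1r.
by rewrite !linearN opprD.
Qed.

(** Up to sign and order of the indices, the s_(a,b) are the actions of the listed generators of
    sp(2n). *)
Lemma is_submoduleP W : is_submodule S W <->
  is_subspace W /\ (forall a b f, W f -> W (s a b f)).
Proof.
split=> -[subW h]; split=> //.
  move=> a b f Wf; have G M : sp_gen M -> W (gl_act S M f).
    by move=> gM; apply: h => //; apply: lspan_gen.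
  have Grr i j : (i <= j)%N -> W (s (rshift n i) (rshift n j) f).
    by move=> ij; rewrite sp_s_rr; apply: G; constructor 2; exists i, j.
  have Gll i j : (i <= j)%N -> W (s (lshift n i) (lshift n j) f).
    move=> ij; rewrite sp_s_ll -scaleN1r; apply: subspZ => //.
    by apply: G; constructor 3; exists i, j.
  have Glr i j : W (s (lshift n i) (rshift n j) f).
    by rewrite sp_s_lr; apply: G; constructor 1; exists i, j.
  elim/barP: a => i; elim/barP: b => j.
  - by case: (leqP i j) => [|/ltnW] ij; [|rewrite sp_s_sym]; apply: Gll.
  - exact: Glr.
  - by rewrite sp_s_sym; apply: Glr.
  - by case: (leqP i j) => [|/ltnW] ij; [|rewrite sp_s_sym]; apply: Grr.
move=> M f gM Wf; apply: gl_act_lspan gM => // {}M [[i [j ->]]|[i [j [_ ->]]]|[i [j [_ ->]]]].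
- by rewrite -sp_s_lr; apply: h.
- by rewrite -sp_s_rr; apply: h.
- by rewrite -[gl_act _ _ _]opprK -sp_s_ll -scaleN1r; apply: subspZ => //; apply: h.
Qed.

Lemma charge_def m :
  \sum_(i in S) (m i)%:Z - \sum_(r in ~: S) (m r)%:Z = charge S m :> int.
Proof.
rewrite /charge [in RHS](bigID (mem S)) /= -sumrN; congr (_ + _).
  by apply: eq_bigr => i iS; rewrite /osc_wt iS.
apply: eq_big => i; first by rewrite inE.
by rewrite inE /osc_wt => /negPf ->.
Qed.

Lemma graded_pieceP k f : graded_piece R S k f <-> has_charge S k f.
Proof.
split.
  apply: subsp_lspan; first exact: has_charge_subspace.
  by move=> _ [m e ->]; rewrite -e charge_def; apply: has_chargeX.
move=> fk; rewrite [f]mpolyE big_seq; apply: subsp_sum; first exact: lspan_subspace.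
move=> m; rewrite mcoeff_msupp => /fk e; apply: subspZ; first exact: lspan_subspace.
by apply: lspan_gen; exists m; rewrite ?charge_def.
Qed.

Lemma graded_piece_submodule k : is_submodule S (graded_piece R S k).
Proof.
apply/is_submoduleP; split; first exact: lspan_subspace.
by move=> a b f /graded_pieceP h; apply/graded_pieceP; apply: has_charge_sp_s.
Qed.

Lemma U_orbit_submodule f : is_submodule S (U_orbit S f).
Proof.
split; first exact: lspan_subspace.
move=> M g gM; apply: (@subsp_lspan _ _ (fun g => U_orbit S f (gl_act S M g))).
  split=> [|c u v hu hv]; first by rewrite linear0; apply: subsp0; apply: lspan_subspace.
  by rewrite linearP; apply: (lspan_subspace _).2.
move=> _ [gs [hgs ->]]; apply: lspan_gen; exists (M :: gs); split=> // M'.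
by rewrite inE => /predU1P[->|/hgs].
Qed.

Lemma U_orbit_self f : U_orbit S f f.
Proof. by apply: lspan_gen; exists [::]. Qed.

Lemma U_orbit_min W f g : is_submodule S W -> W f -> U_orbit S f g -> W g.
Proof.
move=> [subW hW] Wf; apply: subsp_lspan => // _ [gs [hgs ->]].
elim: gs hgs => //= M gs IHgs hgs; apply: hW; first by apply: hgs; rewrite mem_head.
by apply: IHgs => M' hM'; apply: hgs; rewrite inE hM' orbT.
Qed.

Lemma irreducible_generated W f : irreducible_module S W -> W f -> f != 0 -> generates S f W.
Proof.
move=> [subW _ irr] Wf f0 g; split; last exact: U_orbit_min.
case: (irr _ (U_orbit_submodule f)) => [h|h|h]; last exact: h.
  by apply: U_orbit_min.
by rewrite (h f) ?eqxx // in f0; apply: U_orbit_self.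
Qed.

Lemma irreducible_intro W f : is_submodule S W -> W f -> f != 0 ->
  (forall W', is_subspace W' -> (forall a b f, W' f -> W' (s a b f)) ->
     (forall f, W' f -> W f) -> forall f g, W' f -> f != 0 -> W g -> W' g) ->
  irreducible_module S W.
Proof.
move=> subW Wf f0 h; split => //; first by exists f.
move=> W' /is_submoduleP[subW' sW'] W'W.
case: (EM (exists2 g, W' g & g != 0)) => [[g W'g g0]|hn]; [right|left] => g' W'g'.
  exact: (h W' _ _ _ g).
by apply/eqP; apply: contra_notT hn => ?; exists g'.
Qed.

Lemma irreducible_ext W W' : (forall f, W f <-> W' f) ->
  irreducible_module S W -> irreducible_module S W'.
Proof.
move=> e [[[W0 WD] WM] [f Wf f0] irr]; split.
- split; [split; first by apply/e | by move=> M f' ? /e ?; apply/e/WM].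
  by move=> c u v /e ? /e ?; apply/e/WD.
- by exists f => //; apply/e.
- move=> W'' sub h; case: (irr W'' sub) => [g /h /e //|h0|h1]; [left|right] => // g.
  by move=> /e /h1.
Qed.
End Representation.

(** * Highest weight vectors *)

Section HighestWeight.
Variables (R : realType) (n : nat) (S : {set 'I_(n + n)}).
Notation K := R[i].
Notation A := {mpoly K[n + n]}.
Notation p := (@osc_p K _ S).
Notation q := (@osc_q K _ S).
Implicit Types (i j : 'I_n) (m : 'X_{1..n + n}) (f g : A) (M : 'M[K]_(n + n)) (W : A -> Prop).

Definition cartan_act i f : A :=
  p (lshift n i) (q (lshift n i) f) - p (rshift n i) (q (rshift n i) f).

Lemma weight_vectorP f (mu : 'rV[K]_n) :
  (forall i, cartan_act i f = mu 0 i *: f) -> weight_vector S f mu.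
Proof.
move=> h M [m [c [w [hw ->]]]].
have wt_lin : forall c M M', wt_eval mu (c *: M + M') = c * wt_eval mu M + wt_eval mu M'.
  move=> c' M1 M2; rewrite /wt_eval mulr_sumr -big_split /=; apply: eq_bigr => i _.
  by rewrite !mxE; ring.
elim: m c w hw => [|m IHm] c w hw.
  rewrite big_ord0 gl_act0 /wt_eval big1 ?scale0r // => i _.
  by rewrite mxE mulr0.
rewrite big_ord_recl gl_act_linearl wt_lin scalerDl IHm; last by move=> i; apply: hw.
congr (_ + _); case: (hw ord0) => i ->.
rewrite gl_actB !gl_act_delta -scalerA -[_ - _]/(cartan_act i f) h; congr (_ *: (_ *: _)).
rewrite /wt_eval (bigD1 i) //= big1 => [|j ji]; rewrite !mxE.
  by rewrite !eqxx eq_lrshift subr0 mulr1 addr0.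
rewrite eq_lrshift andbF subr0.
by rewrite (inj_eq (@lshift_inj _ _)) (negPf ji) mulr0.
Qed.

Lemma cartan_actX i m : cartan_act i 'X_[m] =
  (osc_wt S (lshift n i) m - (lshift n i \notin S)%:R
   - (osc_wt S (rshift n i) m - (rshift n i \notin S)%:R))%:~R *: 'X_[m].
Proof.
rewrite /cartan_act !osc_pqX -scalerBl; congr (_ *: _).
by rewrite !(rmorphD, rmorphN) /= !rmorph_nat.
Qed.

Lemma hw_module_intro W f (mu : 'rV[K]_n) : irreducible_module S W -> W f -> f != 0 ->
  (forall i, cartan_act i f = mu 0 i *: f) ->
  (forall i j, (i < j)%N ->
     p (lshift n i) (q (lshift n j) f) = p (rshift n j) (q (rshift n i) f)) ->
  (forall i j, (i <= j)%N ->
     p (lshift n i) (q (rshift n j) f) + p (lshift n j) (q (rshift n i) f) = 0) ->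
  hw_module S W f mu.
Proof.
move=> irr Wf f0 /weight_vectorP h1 h2 h3; split=> //; last exact: irreducible_generated.
split=> // [M hM|M]; first by exists (wt_eval mu M); apply: h1.
apply: (@gl_act_lspan _ _ _ _ (fun g => g = 0)) => [|{}M].
  by split=> // c u v -> ->; rewrite scaler0 addr0.
case=> [[i [j [ij ->]]]|[i [j [ij ->]]]|[i ->]].
- by rewrite gl_actB !gl_act_delta h2 // subrr.
- by rewrite gl_actD !gl_act_delta h3 // ltnW.
(* For i = j the hypothesis concerns twice the long root vector E_(i,n+i). *)
- have := h3 i i (leqnn i); rewrite gl_act_delta => /eqP.
  by rewrite -mulr2n -scaler_nat scaler_eq0 pnatr_eq0 => /eqP.
Qed.

Lemma mderiv_power a c k : a != c -> ('X_c ^+ k : A)^`M(a) = 0.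
Proof.
move=> ac; rewrite mpolyXn mderivX mulmnE mnm1E eq_sym (negPf ac) mul0n.
by rewrite scale0r.
Qed.

(** For b in S, q_b is a derivative in a variable other than x_c. For a in T, p_a is such a
    derivative, and it reaches the power first after commuting with q_b. *)
Lemma osc_pq_power a b c k : a != b ->
  (a \notin S) && (a != c) || (b \in S) && (b != c) -> p a (q b ('X_c ^+ k)) = 0.
Proof.
move=> ab /orP[/andP[aT ac]|/andP[bS bc]]; last by rewrite /osc_q bS mderiv_power // linear0.
suff -> : p a (q b ('X_c ^+ k)) = q b (p a ('X_c ^+ k)).
  by rewrite /osc_p (negPf aT) mderiv_power // linear0.
by rewrite osc_qp eq_sym (negPf ab) scale0r addr0.
Qed.

Lemma osc_wt_power a c k :
  osc_wt S a (U_(c) *+ k)%MM = if c == a then (if c \in S then k%:Z else - k%:Z) else 0.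
Proof.
rewrite /osc_wt mulmnE mnm1E; case: eqP => [<-|_]; rewrite ?mul1n ?mul0n //.
by case: ifP.
Qed.

Lemma has_charge_power c k :
  has_charge S (if c \in S then k%:Z else - k%:Z) ('X_c ^+ k : A).
Proof.
rewrite mpolyXn; set z := (if _ then _ else _).
suff <- : charge S (U_(c) *+ k)%MM = z by apply: has_chargeX.
rewrite /charge (bigD1 c) //= osc_wt_power eqxx big1 ?addr0 // => a ac.
by rewrite osc_wt_power eq_sym (negPf ac).
Qed.

Lemma xvarE (c : 'I_(n + n)) a : a = c.+1 -> xvar R n a = 'X_c.
Proof.
move=> ->; rewrite /xvar (big_pred1 c) // => i; exact: eqSS.
Qed.

Lemma hw_module_power W c k (mu : 'rV[K]_n) :
  irreducible_module S W -> W ('X_c ^+ k) ->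
  (forall i, (osc_wt S (lshift n i) (U_(c) *+ k)%MM - (lshift n i \notin S)%:R
   - (osc_wt S (rshift n i) (U_(c) *+ k)%MM - (rshift n i \notin S)%:R))%:~R = mu 0 i) ->
  let kills a b := (a \notin S) && (a != c) || (b \in S) && (b != c) in
  (forall i j, kills (lshift n i) (rshift n j)) ->
  (forall i j, (i < j)%N -> kills (lshift n i) (lshift n j) && kills (rshift n j) (rshift n i)) ->
  hw_module S W ('X_c ^+ k) mu.
Proof.
move=> irr Wf hmu kills hlr hij.
have ne i j : (i < j)%N -> i != j by apply: contraTneq => ->; rewrite ltnn.
apply: (hw_module_intro irr Wf); first by rewrite mpolyXn mpolyX_neq0.
- by move=> i; rewrite mpolyXn cartan_actX hmu.
- move=> i j ij; have /andP[h1 h2] := hij i j ij.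
  rewrite !osc_pq_power //.
    by rewrite (inj_eq (@rshift_inj _ _)) eq_sym ne.
  by rewrite (inj_eq (@lshift_inj _ _)) ne.
- move=> i j _; rewrite !osc_pq_power ?addr0 ?eq_lrshift //; exact: hlr.
Qed.

(* If x_i, x_(n+i) lie on the S side and x_j, x_(n+j) on the T side, the roots 2 eps_i, 2 eps_j
   make f constant in x_(n+i) and x_j, so that E_(i,n+j) + E_(j,n+i) multiplies f by a monomial. *)
Lemma singular_both_eq0 f i j :
  lshift n i \in S -> rshift n i \in S -> lshift n j \notin S -> rshift n j \notin S ->
  singular_vector S f -> False.
Proof.
move=> li ri lj rj [/negP f0 _ sf]; apply: f0.
have G M : pos_root_vector M -> gl_act S M f = 0 by move=> h; apply/sf/lspan_gen.
have X0 a (g : A) : 'X_a * g = 0 -> g = 0.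
  by move=> /eqP; rewrite mulf_eq0 (negPf (mpolyX_neq0 _ _)) => /eqP.
have di : f^`M(rshift n i) = 0.
  apply: (X0 (lshift n i)); rewrite -[RHS](G (delta_mx (lshift n i) (rshift n i))).
    by rewrite gl_act_delta /osc_p /osc_q li ri.
  by constructor 3; exists i.
have dj : f^`M(lshift n j) = 0.
  apply: (X0 (rshift n j)); apply/eqP; rewrite -oppr_eq0; apply/eqP.
  rewrite -[RHS](G (delta_mx (lshift n j) (rshift n j))); last by constructor 3; exists j.
  rewrite gl_act_delta /osc_p /osc_q (negPf lj) (negPf rj) linearN /= mderiv_mulX.
  by rewrite eq_lrshift scale0r addr0.
have e1 : p (lshift n j) (q (rshift n i) f) = 0.
  by rewrite /osc_p /osc_q (negPf lj) ri di linear0.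
have ij : i != j by apply: contraNneq lj => <-.
have e2 : p (lshift n i) (q (rshift n j) f) = 0.
  move: ij; rewrite -val_eqE neq_ltn => /orP[] h.
  - have := G (delta_mx (lshift n i) (rshift n j) + delta_mx (lshift n j) (rshift n i)).
    by rewrite gl_actD !gl_act_delta e1 addr0; apply; constructor 2; exists i, j.
  - have := G (delta_mx (lshift n j) (rshift n i) + delta_mx (lshift n i) (rshift n j)).
    by rewrite gl_actD !gl_act_delta e1 add0r; apply; constructor 2; exists j, i.
move: e2; rewrite /osc_p /osc_q li (negPf rj) mulrN => /eqP; rewrite oppr_eq0 => /eqP.
by move=> /X0 /X0 ->.
Qed.

End HighestWeight.

(** * Irreducibility of A_<k> when S_1 or T_1 is nonempty *)

Section Cases.
Variables (R : realType) (n : nat) (S : {set 'I_(n + n)}).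
Notation K := R[i].
Notation A := {mpoly K[n + n]}.
Implicit Types (i j : 'I_n) (f g : A) (W : A -> Prop).

(** The power of x_c is only there to show that A_<k> is nonzero: it has charge k when c is on the
    side, S or T, that matches the sign of k. *)
Lemma graded_piece_irreducible (k : int) c :
  let k' := if c \in S then k else - k in 0 <= k' ->
  (forall W, is_subspace W -> (forall a b f, W f -> W (sp_s S a b f)) ->
     forall a b f, W f -> has_charge S k f -> W (sp_t S a b f)) ->
  irreducible_module S (graded_piece R S k).
Proof.
move=> k' k0 h.
apply: (@irreducible_intro _ _ _ _ ('X_c ^+ `|k'|)).
- exact: graded_piece_submodule.
- apply/graded_pieceP; have := @has_charge_power R n S c `|k'|.
  by rewrite gez0_abs // /k'; case: (c \in S); rewrite ?opprK.
- by rewrite mpolyXn mpolyX_neq0.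
move=> W subW sW Wk f g Wf f0 /graded_pieceP gk.
apply: (@sp_t_stable_full _ _ S W subW sW k f g) => //.
  by move=> a b f' Wf' fk; apply: (h W).
by move=> f' /Wk /graded_pieceP.
Qed.

Lemma irreducible_of_both (T : {set 'I_(n + n)}) (k : int) : T = ~: S -> S != set0 -> T != set0 ->
  both S :|: both T != set0 -> irreducible_module S (graded_piece R S k).
Proof.
move=> hT /set0Pn[c cS] /set0Pn[d]; rewrite hT inE => dT /set0Pn[i hi].
pose e := if 0 <= k then c else d.
apply: (@graded_piece_irreducible k e).
  rewrite /e; case: (lerP 0 k) => hk; first by rewrite cS.
  by rewrite (negPf dT) oppr_ge0 ltW.
move=> W subW sW a b f Wf _; apply: (@sp_t_stable_definite _ _ S W subW sW i) => //.
by move: hi; rewrite !inE; case: (_ \in S); case: (_ \in S).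
Qed.
End Cases.

Lemma mxE_mulrz (V : zmodType) (m n : nat) (M : 'M[V]_(m, n)) (z : int) i j :
  (M *~ z) i j = M i j *~ z.
Proof. by case: z => k; rewrite ?NegzE ?mulrNz ?mxE -!pmulrn mulmxnE. Qed.

(** * Highest weight vectors for T = {1, ..., t}, and the parts of A_<0> *)

Section InitialT.
Variables (R : realType) (n : nat).
Notation K := R[i].
Notation A := {mpoly K[n + n]}.
Implicit Types (i j : 'I_n) (f g : A) (W : A -> Prop).

Lemma lshift_initialC t i : (lshift n i \in ~: initial n t) = (t <= i)%N.
Proof. by rewrite !inE -leqNgt. Qed.
Lemma rshift_initialC t i : (t <= n)%N -> rshift n i \in ~: initial n t.
Proof. by move=> tn; rewrite !inE -leqNgt /=; lia. Qed.

Lemma hw_module_initial_ge0 t (k : int) : (0 < t)%N -> (t < n)%N -> 0 <= k ->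
  irreducible_module (~: initial n t) (graded_piece R (~: initial n t) k) ->
  hw_module (~: initial n t) (graded_piece R (~: initial n t) k) (xvar R n t.+1 ^+ `|k|%N)
    (fund_wt R n t *~ (- (k + 1)) + fund_wt R n t.+1 *~ k).
Proof.
move=> t0 tn k0 irr; have tn' := ltnW tn.
(* The variable x_(t+1) of the text has 0-based index t, the first index in S. *)
pose c := lshift n (Ordinal tn).
have cS : c \in ~: initial n t by rewrite lshift_initialC.
rewrite (@xvarE R n c) //; apply: hw_module_power => //.
- apply/graded_pieceP; have := @has_charge_power R n (~: initial n t) c `|k|.
  by rewrite cS gez0_abs.
- move=> i; rewrite mxE !mxE_mulrz !mxE !osc_wt_power cS lshift_initialC rshift_initialC //.
  rewrite gez0_abs //.
  rewrite eq_lrshift (inj_eq (@lshift_inj _ _)) -val_eqE /= !pmulrn -!mulrzA -mulrzDr.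
  congr (_%:~R); case: (ltngtP i t) => h; rewrite ?h ?leqnn /= ?ltnS ?h /=; lia.
- move=> i j; rewrite rshift_initialC //= eq_sym eq_rlshift; exact: orbT.
- move=> i j ij; rewrite !rshift_initialC //= eq_rlshift !lshift_initialC.
  rewrite !(inj_eq (@lshift_inj _ _)) -!val_eqE /=; lia.
Qed.

(** The value t = n is allowed so that the lemma also covers negative charges when T = {1, ...,
    n}. *)
Lemma hw_module_initial_lt0 t (k : int) : (0 < t)%N -> (t <= n)%N -> k <= 0 ->
  irreducible_module (~: initial n t) (graded_piece R (~: initial n t) k) ->
  hw_module (~: initial n t) (graded_piece R (~: initial n t) k) (xvar R n t ^+ `|k|%N)
    (fund_wt R n t.-1 *~ (- k) + fund_wt R n t *~ (k - 1)).
Proof.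
move=> t0 tn k0 irr.
have tn' : (t.-1 < n)%N by lia.
pose c := lshift n (Ordinal tn').
have cS : c \in ~: initial n t = false by rewrite lshift_initialC /=; lia.
rewrite (@xvarE R n c) /=; last by lia.
apply: hw_module_power => //.
- apply/graded_pieceP; have := @has_charge_power R n (~: initial n t) c `|k|.
  by rewrite cS lez0_abs // opprK.
- move=> i; rewrite mxE !mxE_mulrz !mxE !osc_wt_power cS lshift_initialC rshift_initialC //.
  rewrite lez0_abs //.
  rewrite eq_lrshift (inj_eq (@lshift_inj _ _)) -val_eqE /= !pmulrn -!mulrzA -mulrzDr.
  congr (_%:~R); case: (ltngtP i t.-1) => h; lia.
- move=> i j; rewrite rshift_initialC //= eq_rlshift; exact: orbT.
- move=> i j ij; rewrite !rshift_initialC //= eq_rlshift !lshift_initialC.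
  rewrite !(inj_eq (@lshift_inj _ _)) -!val_eqE /=; lia.
Qed.

(** W is left free, so that this serves both A_<k> and, at k = 0, the module generated by 1. *)
Lemma hw_module_initial_n W (k : nat) : (0 < n)%N ->
  irreducible_module (~: initial n n) W -> W (xvar R n (2 * n)%N ^+ k) ->
  hw_module (~: initial n n) W (xvar R n (2 * n)%N ^+ k)
    (fund_wt R n n.-1 *+ k - fund_wt R n n *+ k.+1).
Proof.
move=> n0 irr.
have tn' : (n.-1 < n)%N by lia.
pose c := rshift n (Ordinal tn').
have cS : c \in ~: initial n n by rewrite rshift_initialC.
rewrite (@xvarE R n c) /=; last by lia.
move=> Wc; apply: hw_module_power => //.
- move=> i; rewrite !mxE !mulmxnE !mxE !osc_wt_power cS lshift_initialC rshift_initialC //.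
  rewrite eq_rlshift (inj_eq (@rshift_inj _ _)) -val_eqE /=.
  rewrite -!mulrnA !pmulrn -mulrzBr.
  congr (_%:~R); case: (ltngtP i n.-1) => h; lia.
- move=> i j; rewrite lshift_initialC -ltnNge ltn_ord eq_lrshift //.
- move=> i j ij; rewrite !rshift_initialC //= eq_lrshift lshift_initialC -ltnNge ltn_ord.
  by rewrite !(inj_eq (@rshift_inj _ _)) -!val_eqE /=; have := ltn_ord j; lia.
Qed.

Notation S0 := (~: initial n n).

Lemma lshift_S0 i : lshift n i \notin S0.
Proof. by rewrite lshift_initialC -ltnNge. Qed.
Lemma rshift_S0 i : rshift n i \in S0.
Proof. exact: rshift_initialC. Qed.

Definition bracket i j : A :=
  'X_(lshift n i) * 'X_(rshift n j) - 'X_(lshift n j) * 'X_(rshift n i).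

Lemma mderiv_var (V : numFieldType) (N : nat) (a b : 'I_N) :
  ('X_b)^`M(a) = (a == b)%:R :> {mpoly V[N]}.
Proof.
rewrite -['X_b]mulr1 mderiv_mulX mderivC mulr0 add0r -mul_mpolyC mulr1.
by rewrite -mpolyC_nat.
Qed.

Lemma mderiv_bracket_l i j k : (bracket i j)^`M(lshift n k)
  = (k == i)%:R * 'X_(rshift n j) - (k == j)%:R * 'X_(rshift n i).
Proof.
rewrite /bracket linearB /= !mderivM !mderiv_var !eq_lrshift !(inj_eq (@lshift_inj _ _)).
by rewrite !mulr0 !addr0.
Qed.
Lemma mderiv_bracket_r i j k : (bracket i j)^`M(rshift n k)
  = (k == j)%:R * 'X_(lshift n i) - (k == i)%:R * 'X_(lshift n j).
Proof.
rewrite /bracket linearB /= !mderivM !mderiv_var !eq_rlshift !(inj_eq (@rshift_inj _ _)).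
by rewrite !mul0r !add0r mulrC ['X_(lshift n j) * _]mulrC.
Qed.

Lemma swap_bracket i j : swap_op (bracket i j) = - bracket i j.
Proof.
rewrite /bracket linearB /= !swap_opM !swap_opX !bar_lshift !bar_rshift opprB.
by rewrite mulrC ['X_(rshift n j) * _]mulrC.
Qed.

Lemma bracket_neq0 i j : i != j -> bracket i j != 0.
Proof.
move=> ij; apply/eqP => /(congr1 (fun f => f^`M(lshift n i)^`M(rshift n j))) /eqP.
rewrite mderiv_bracket_l eqxx (negPf ij) mul1r mul0r subr0 mderiv_var eqxx !linear0.
by rewrite oner_eq0.
Qed.

(** The eigenvalue on x_i x_(n+j) is symmetric in i and j, so both monomials of the bracket have the
    same weight. *)
Lemma cartan_bracket i j k : i != j ->
  cartan_act S0 k (bracket i j) = (- (1 + ((k == i) || (k == j))%:R)) *: bracket i j.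
Proof.
move=> ij.
have E i' j' : cartan_act S0 k ('X_(lshift n i') * 'X_(rshift n j') : A) =
    (- (1 + (k == i')%:R + (k == j')%:R)) *: ('X_(lshift n i') * 'X_(rshift n j') : A).
  rewrite -mpolyXD cartan_actX; congr (_ *: _).
  rewrite /osc_wt (negPf (lshift_S0 k)) rshift_S0 /= !mnmDE !mnm1E.
  rewrite !eq_lrshift !eq_rlshift !(inj_eq (@lshift_inj _ _)) !(inj_eq (@rshift_inj _ _)).
  rewrite ![_ == k]eq_sym add0n addn0 !(rmorphD, rmorphN) /= !rmorph_nat; ring.
have cartanB (f g : A) : cartan_act S0 k (f - g) = cartan_act S0 k f - cartan_act S0 k g.
  have pqB a : osc_p S0 a (osc_q S0 a (f - g)) =
      osc_p S0 a (osc_q S0 a f) - osc_p S0 a (osc_q S0 a g).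
    exact: (linearB (osc_p S0 a \o osc_q S0 a : {linear A -> A})).
  have sub4 (a b c d : A) : a - b - (c - d) = a - c - (b - d) by ring.
  by rewrite /cartan_act !pqB sub4.
rewrite /bracket cartanB !E.
have -> : ((k == i) || (k == j))%:R = (k == i)%:R + (k == j)%:R :> K.
  by case: (eqVneq k i) => [->|_]; rewrite ?(negPf ij) ?addr0 ?add0r.
by rewrite [1 + (k == j)%:R + _]addrAC -scalerBr addrA.
Qed.

Lemma chargeD (N : nat) (S : {set 'I_N}) (m1 m2 : 'X_{1..N}) :
  charge S (m1 + m2)%MM = charge S m1 + charge S m2.
Proof.
rewrite /charge -big_split /=; apply: eq_bigr => a _; rewrite /osc_wt mnmDE.
by case: ifP => _; rewrite PoszD // opprD.
Qed.

Lemma chargeU (N : nat) (S : {set 'I_N}) a : charge S U_(a)%MM = (-1) ^+ (a \notin S).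
Proof.
rewrite /charge (bigD1 a) //= big1 => [|b ba]; rewrite /osc_wt mnm1E ?eqxx.
  by case: ifP.
by rewrite eq_sym (negPf ba) oppr0 if_same.
Qed.

Lemma charge0_part_bracket i j : charge0_part S0 true (bracket i j).
Proof.
split; last by rewrite swap_bracket expr1 scaleN1r.
have sub := has_charge_subspace K S0 0.
have E i' j' : has_charge S0 0 ('X_(lshift n i') * 'X_(rshift n j') : A).
  rewrite -mpolyXD -[X in has_charge _ X](_ : charge S0 (U_(lshift n i') + U_(rshift n j'))%MM = 0).
    exact: has_chargeX.
  by rewrite chargeD !chargeU lshift_S0 rshift_S0 /= addNr.
exact: (subspB sub).
Qed.

Lemma charge0_part_1 : charge0_part S0 false (1 : A).
Proof.
by split; [exact: has_charge1 | rewrite expr0 scale1r /swap_op rmorph1].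
Qed.

Lemma charge0_part_irr e f : charge0_part S0 e f -> f != 0 ->
  irreducible_module S0 (@charge0_part K n S0 e).
Proof.
move=> fe f0; apply: (irreducible_intro _ fe f0).
  apply/is_submoduleP; split; first exact: charge0_part_subspace.
  move=> a b g; apply: charge0_part_sp_s; [exact: lshift_S0|exact: rshift_S0].
move=> W subW sW We g h Wg g0 hh.
exact: (@charge0_part_irreducible _ _ _ lshift_S0 rshift_S0 W subW sW e g).
Qed.

Lemma U_orbit_charge0 e f : charge0_part S0 e f -> f != 0 ->
  forall g, U_orbit S0 f g <-> charge0_part S0 e g.
Proof.
move=> fe f0 g; split=> h.
  by apply/(irreducible_generated (charge0_part_irr fe f0) fe f0 g).
by apply/(irreducible_generated (charge0_part_irr fe f0) fe f0 g).
Qed.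

Lemma U_orbit_charge0_irr e f : charge0_part S0 e f -> f != 0 ->
  irreducible_module S0 (U_orbit S0 f).
Proof.
move=> fe f0; apply: (irreducible_ext _ (charge0_part_irr fe f0)) => g.
by split => /(U_orbit_charge0 fe f0).
Qed.

Lemma U_orbit_direct_sum f g : charge0_part S0 false f -> f != 0 ->
  charge0_part S0 true g -> g != 0 ->
  is_direct_sum (graded_piece R S0 0) (U_orbit S0 f) (U_orbit S0 g).
Proof.
move=> fe f0 ge g0; split.
  move=> h; split.
    move=> /graded_pieceP /charge0_part_decomp[||u1 [u2 [h1 h2 ->]]].
    - exact: lshift_S0.
    - exact: rshift_S0.
    by exists u1, u2; split=> //; [apply/(U_orbit_charge0 fe f0)|apply/(U_orbit_charge0 ge g0)].
  move=> [u1 [u2 [/(U_orbit_charge0 fe f0)[h1 _] /(U_orbit_charge0 ge g0)[h2 _] ->]]].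
  by apply/graded_pieceP; apply: (subspD (has_charge_subspace K S0 0)).
move=> u /(U_orbit_charge0 fe f0) h1 /(U_orbit_charge0 ge g0) h2.
exact: (charge0_part_disjoint h1 h2).
Qed.

(** Since i and j are the last two indices, E_(k,l) - E_(n+l,n+k) with k < l meets the bracket only
    for k = i and l = j, where its two terms cancel. The other positive root vectors act by second
    derivatives, which cancel by antisymmetry of the bracket. *)
Lemma hw_module_bracket i j (mu : 'rV[K]_n) : (i.+1 = j)%N -> (j.+1 = n)%N ->
  (forall k, mu 0 k = - (1 + ((k == i) || (k == j))%:R)) ->
  hw_module S0 (U_orbit S0 (bracket i j)) (bracket i j) mu.
Proof.
move=> ij jn hmu; have neij : i != j by rewrite -val_eqE /= -ij; lia.
have b0 := bracket_neq0 neij.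
have irr := U_orbit_charge0_irr (charge0_part_bracket i j) b0.
apply: (hw_module_intro irr (U_orbit_self _ _) b0).
- by move=> k; rewrite cartan_bracket // hmu.
- move=> k l kl; rewrite /osc_p /osc_q !(negPf (lshift_S0 _)) !rshift_S0 linearN /= mderiv_mulX.
  rewrite (inj_eq (@lshift_inj _ _)) -val_eqE /= (ltn_eqF kl) scale0r addr0.
  rewrite mderiv_bracket_l mderiv_bracket_r.
  have -> : (k == j) = false by apply/eqP => e; move: kl (ltn_ord l); rewrite e; lia.
  case: (eqVneq k i) => [e|_]; last by rewrite !mul0r subrr !mulr0 oppr0.
  have -> : l = j by apply/val_inj => /=; move: kl (ltn_ord l); rewrite e; lia.
  by rewrite !mul0r !mul1r subr0 sub0r mulrN mulrC.
- move=> k l _; rewrite /osc_p /osc_q !(negPf (lshift_S0 _)) !rshift_S0.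
  rewrite !mderiv_bracket_r !linearB /= !mderivM !mderiv_var -!mpolyC_nat !mderivC.
  rewrite !(inj_eq (@lshift_inj _ _)) !mul0r !add0r -!mpolyCM -!mpolyCB -mpolyCD.
  rewrite [X in X%:MP](_ : _ = 0) ?mpolyC0 //; ring.
Qed.
End InitialT.

(** * The polarization operator and straightening *)

Section Polarization.
Variables (K : numFieldType) (n : nat).
Notation A := {mpoly K[n + n]}.
Notation x i := ('X_(lshift n i) : A).
Notation y i := ('X_(rshift n i) : A).
Implicit Types (i j t : 'I_n) (f g : A).

(** The operator L: the polarization of classical invariant theory, a derivation sending x_i to y_i
    = x_(n+i) and killing y_i. *)
Definition polar f : A := \sum_i y i * f^`M(lshift n i).

Fact polar_is_linear : linear polar.
Proof.
move=> c f g; rewrite /polar scaler_sumr -big_split; apply: eq_bigr => i _ /=.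
by rewrite linearP mulrDr scalerAr.
Qed.
HB.instance Definition _ := GRing.isLinear.Build K A A *:%R polar polar_is_linear.

Lemma polarM f g : polar (f * g) = polar f * g + f * polar g.
Proof.
rewrite /polar mulr_suml mulr_sumr -big_split; apply: eq_bigr => i _ /=.
by rewrite mderivM; ring.
Qed.

Lemma polar_x t : polar (x t) = y t.
Proof.
rewrite /polar (bigD1 t) //= mderiv_var eqxx mulr1 big1 ?addr0 // => i it.
by rewrite mderiv_var (inj_eq (@lshift_inj _ _)) (negPf it) mulr0.
Qed.

Lemma polar_y t : polar (y t) = 0.
Proof. by rewrite /polar big1 // => i _; rewrite mderiv_var eq_lrshift mulr0. Qed.

Lemma polar_1 : polar 1 = 0.
Proof. by rewrite -mpolyC1 /polar big1 // => i _; rewrite mderivC mulr0. Qed.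

Definition pol r f : A := iter r polar f.
Fact pol_is_linear r : linear (pol r).
Proof. by move=> c f g; elim: r => //= r ->; rewrite linearP. Qed.
HB.instance Definition _ r := GRing.isLinear.Build K A A *:%R (pol r) (pol_is_linear r).

Lemma polS r f : pol r.+1 f = polar (pol r f). Proof. by []. Qed.
Lemma polSr r f : pol r.+1 f = pol r (polar f). Proof. exact: iterSr. Qed.
Lemma polD r k f : pol (r + k) f = pol r (pol k f). Proof. exact: iterD. Qed.

Lemma pol_y r t f : pol r (y t * f) = y t * pol r f.
Proof. by elim: r => // r IHr; rewrite !polS IHr polarM polar_y mul0r add0r. Qed.

(** Leibniz rule for L^r: since L^2 x_t = 0, only the terms with at most one L on x_t survive. *)
Lemma pol_x_polar r t f :
  pol r (x t * polar f) = x t * pol r.+1 f + r%:R *: (y t * pol r f).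
Proof.
elim: r => [|r IHr]; first by rewrite scale0r addr0.
rewrite polS IHr linearD linearZ /= !polarM polar_x polar_y -!polS mul0r add0r.
by rewrite -!mul_mpolyC -natr1 mpolyCD mpolyC1; ring.
Qed.

(* The vectors (x_i, y_i), extended by (0, -1) at index 0, so that the 2x2 minors with index 0
   are the variables x_j. *)
Definition ext_x (a : 'I_n.+1) : A := if unlift ord0 a is Some i then x i else 0.
Definition ext_y (a : 'I_n.+1) : A := if unlift ord0 a is Some i then y i else -1.
Definition minor (a b : 'I_n.+1) : A := ext_x a * ext_y b - ext_x b * ext_y a.

Lemma minor0 j : minor ord0 (lift ord0 j) = x j.
Proof. by rewrite /minor /ext_x /ext_y unlift_none liftK mul0r mulrN1 opprK add0r. Qed.

Lemma minor_lift i j : minor (lift ord0 i) (lift ord0 j) = x i * y j - x j * y i.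
Proof. by rewrite /minor /ext_x /ext_y !liftK. Qed.

Lemma minorC a b : minor a b = - minor b a.
Proof. by rewrite /minor opprB. Qed.

Lemma minor_same a : minor a a = 0.
Proof. exact: subrr. Qed.

Lemma minor_plucker a b c d :
  minor a d * minor b c = minor a c * minor b d - minor a b * minor c d.
Proof. by rewrite /minor; ring. Qed.

Lemma polar_minor_lift i j : polar (minor (lift ord0 i) (lift ord0 j)) = 0.
Proof. by rewrite minor_lift linearB /= !polarM !polar_x !polar_y; ring. Qed.

Notation pairs := (seq ('I_n.+1 * 'I_n.+1)).
Implicit Type s : pairs.

Definition minors s : A := \prod_(e <- s) minor e.1 e.2.
Definition valid s := all (fun e : 'I_n.+1 * 'I_n.+1 => (e.1 < e.2)%N) s.
Definition xcount s := count (fun e : 'I_n.+1 * 'I_n.+1 => e.1 == ord0) s.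

Definition minor_span : A -> Prop := lspan (fun f => exists2 s, valid s & f = minors s).

Lemma minors_cons a b s : minors ((a, b) :: s) = minor a b * minors s.
Proof. by rewrite /minors big_cons. Qed.

Lemma minor_span_mul a b f : minor_span f -> minor_span (minor a b * f).
Proof.
have sub := lspan_subspace (fun f => exists2 s, valid s & f = minors s).
apply: (@subsp_lspan _ _ (fun f => minor_span (minor a b * f))).
  split; first by rewrite mulr0; apply: subsp0.
  by move=> c u v hu hv; rewrite mulrDr -scalerAr; apply: sub.2.
move=> _ [s vs ->]; case: (ltngtP a b) => ab.
- by apply: lspan_gen; exists ((a, b) :: s); rewrite ?minors_cons //= ab.
- rewrite minorC mulNr -scaleN1r; apply: subspZ => //.
  by apply: lspan_gen; exists ((b, a) :: s); rewrite ?minors_cons //= ab.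
- by rewrite (ord_inj ab) minor_same mul0r; apply: subsp0.
Qed.

(** Leibniz rule over the factors: L kills a minor with positive indices, and a factor x_j
    contributes x_t y_j = y_t x_j + (x_t y_j - x_j y_t), where the last term is again a minor. *)
Lemma minor_span_polar t s : valid s ->
  minor_span (x t * polar (minors s) - (xcount s)%:R *: (y t * minors s)).
Proof.
have sub := lspan_subspace (fun f => exists2 s, valid s & f = minors s).
elim: s => [_|[a b] s IHs /= /andP[ab vs]].
  by rewrite /minors big_nil polar_1 mulr0 scale0r subrr; apply: subsp0.
have {}IHs := IHs vs; rewrite minors_cons polarM.
case: (unliftP ord0 b) => [j|] hb; last by rewrite hb in ab.
case: (unliftP ord0 a) => [i|] ha.
  rewrite ha hb polar_minor_lift mul0r !add0r.
  have -> : (lift ord0 i == ord0) = false by [].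
  rewrite /= add0n mulrCA [y t * _]mulrCA scalerAr -mulrBr.
  exact: minor_span_mul.
rewrite ha hb minor0 polar_x eqxx.
have -> : x t * (y j * minors s + x j * polar (minors s))
   - (true + xcount s)%:R *: (y t * (x j * minors s)) =
   minor (lift ord0 t) (lift ord0 j) * minors s + minor ord0 (lift ord0 j) *
    (x t * polar (minors s) - (xcount s)%:R *: (y t * minors s)).
  rewrite minor_lift minor0 -!mul_mpolyC natrD mpolyCD mpolyC1; ring.
apply: subspD => //; apply: minor_span_mul => //.
by apply: lspan_gen; exists s.
Qed.

End Polarization.

Section Straightening.
Variables (K : numFieldType) (n : nat).
Notation A := {mpoly K[n + n]}.
Notation x i := ('X_(lshift n i) : A).
Notation y i := ('X_(rshift n i) : A).
Notation pairs := (seq ('I_n.+1 * 'I_n.+1)).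
Notation minors := (@minors K n).
Notation minor := (@minor K n).
Implicit Types (i j t : 'I_n) (f g : A) (s : pairs) (a b c d : 'I_n.+1).

Definition pol_minors f : Prop := exists r s, valid s /\ f = pol r (minors s).

(** With h a product of minors having z factors x_j, the vector (z + 1) y_t L^r h equals L^(r+1)(x_t
    h) - L^r(x_t L h - z y_t h). The argument of the last L^r is a combination of products of minors
    by [minor_span_polar]. *)
Lemma pol_minors_mul_y t f : lspan pol_minors f -> lspan pol_minors (y t * f).
Proof.
have sub := lspan_subspace pol_minors.
apply: (@subsp_lspan _ _ (fun f => lspan pol_minors (y t * f))).
  split; first by rewrite mulr0; apply: subsp0.
  by move=> c u v hu hv; rewrite mulrDr -scalerAr; apply: sub.2.
move=> _ [r [s [vs ->]]].
pose h := minors s; pose z := xcount s.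
suff -> : y t * pol r h = z.+1%:R^-1 *:
    (pol r.+1 (x t * h) - pol r (x t * polar h - z%:R *: (y t * h))).
  apply: subspZ => //; apply: subspB => //.
    apply: lspan_gen; exists r.+1, ((ord0, lift ord0 t) :: s).
    by rewrite minors_cons minor0.
  apply: (@subsp_lspan _ _ (fun f => lspan pol_minors (pol r f))) (minor_span_polar K t vs).
    split; first by rewrite linear0; apply: subsp0.
    by move=> c u v hu hv; rewrite linearP; apply: sub.2.
  by move=> _ [s' vs' ->]; apply: lspan_gen; exists r, s'.
have -> : pol r.+1 (x t * h) = y t * pol r h + (x t * pol r.+1 h + r%:R *: (y t * pol r h)).
  by rewrite polSr polarM polar_x linearD /= pol_y pol_x_polar.
have -> : pol r (x t * polar h - z%:R *: (y t * h)) =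
    x t * pol r.+1 h + r%:R *: (y t * pol r h) - z%:R *: (y t * pol r h).
  by rewrite linearB linearZ /= pol_y pol_x_polar.
set u := y t * _; set v := _ + _ *: _.
have -> : u + v - (v - z%:R *: u) = z.+1%:R *: u.
  by rewrite opprB addrACA addrN addr0 -natr1 scalerDl scale1r addrC.
by rewrite scalerA mulVf ?scale1r // pnatr_eq0.
Qed.

Lemma minors_cat s1 s2 : minors (s1 ++ s2) = minors s1 * minors s2.
Proof. exact: big_cat. Qed.

(** A monomial in the x_i is a product of minors with index 0; the factors y_i are then multiplied
    in one by one. *)
Lemma pol_minors_full f : lspan pol_minors f.
Proof.
have sub := lspan_subspace pol_minors.
rewrite [f]mpolyE; apply: (subsp_sum sub) => m _; apply: (subspZ sub).
rewrite mpolyXE_id big_split_ord /= mulrC.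
have Y i k g : lspan pol_minors g -> lspan pol_minors (y i ^+ k * g).
  move=> hg; elim: k => [|k IHk]; first by rewrite mul1r.
  by rewrite exprS -mulrA; apply: pol_minors_mul_y.
have HY g : lspan pol_minors g ->
    lspan pol_minors (\prod_(i < n) y i ^+ m (rshift n i) * g).
  elim/big_ind: _ g => [g|P1 P2 h1 h2 g hg|i _ g hg].
  - by rewrite mul1r.
  - by rewrite -mulrA; apply/h1/h2.
  - exact: Y.
apply: HY.
apply: lspan_gen.
suff [s vs ->] : exists2 s, valid s & \prod_(i < n) x i ^+ m (lshift n i) = minors s.
  by exists 0, s.
elim/big_ind: _ => [|P1 P2 [s1 v1 ->] [s2 v2 ->]|i _].
- by exists [::] => //; rewrite /minors big_nil.
- by exists (s1 ++ s2); rewrite ?minors_cat // /valid all_cat; apply/andP.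
exists (nseq (m (lshift n i)) (ord0, lift ord0 i)); first by rewrite /valid all_nseq orbT.
elim: (m _) => [|k IHk]; first by rewrite /minors big_nil.
by rewrite exprS IHk /= minors_cons minor0.
Qed.

(* Nested pairs a < b < c < d are the non-standard ones; the Pluecker relation replaces them by
   pairs with a smaller sum of squared lengths. *)
Definition nested (e e' : 'I_n.+1 * 'I_n.+1) := (e.1 < e'.1)%N && (e'.2 < e.2)%N.
Definition standard s := all (fun e => all (fun e' => ~~ nested e e') s) s.

(** Induction on the sum of squared lengths [mu]. The number of factors x_j is kept because in a < b
    < c < d only a can be the index 0, and each product in the relation has exactly one pair
    starting with a. *)
Lemma minors_standard s : valid s ->
  lspan (fun f => exists s', [/\ valid s', standard s', xcount s' = xcount s & f = minors s'])
    (minors s).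
Proof.
pose mu s := (\sum_(e <- s) (e.2 - e.1) ^ 2)%N.
have [k] := ubnP (mu s); elim: k s => // k IHk s lek vs.
case: (boolP (standard s)) => [st|]; first by apply: lspan_gen; exists s.
case/allPn => e es /allPn[e' e's]; rewrite negbK => /andP[ac db].
have ne : e' != e by apply: contraTneq ac => ->; rewrite ltnn.
have [s' ps] : exists s', perm_eq s (e :: e' :: s').
  exists (rem e' (rem e s)); apply: (perm_trans (perm_to_rem es)); rewrite perm_cons.
  by apply: perm_to_rem; move: e's; rewrite (perm_mem (perm_to_rem es)) inE (negPf ne).
have /= : valid (e :: e' :: s') by rewrite /valid -(perm_all _ ps).
case: e e' {es e's ne} ac db ps => [a d] [b c] /= ac db ps /and3P[ad bc vs'].
have -> : minors s = minors ((a, c) :: (b, d) :: s') - minors ((a, b) :: (c, d) :: s').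
  rewrite [minors s](perm_big _ ps) !minors_cons -/(minors _) !minors_cons !mulrA.
  by rewrite minor_plucker mulrBl.
have sub := lspan_subspace (fun f => exists s'',
  [/\ valid s'', standard s'', xcount s'' = xcount s & f = minors s'']).
have xs : xcount s = ((a == ord0) + xcount s')%N.
  rewrite /xcount (seq.permP ps) /= -/(xcount _).
  by rewrite -[b == ord0]val_eqE /= (gtn_eqF (leq_ltn_trans (leq0n a) ac)).
have mus : mu s = ((d - a) ^ 2 + ((c - b) ^ 2 + mu s'))%N.
  by rewrite /mu (perm_big _ ps) !big_cons.
have H e1 e2 : valid [:: e1; e2] -> (mu [:: e1; e2] < (d - a) ^ 2 + (c - b) ^ 2)%N ->
   e1.1 = a -> (0 < e2.1)%N ->
   lspan (fun f => exists s'', [/\ valid s'', standard s'', xcount s'' = xcount s & f = minors s''])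
    (minors (e1 :: e2 :: s')).
  move=> v12 mu12 e1a e2b.
  have e20 : (e2.1 == ord0) = false by rewrite -val_eqE /= gtn_eqF.
  have <- : xcount (e1 :: e2 :: s') = xcount s by rewrite xs /xcount /= e1a e20.
  apply: IHk; last by move: v12 => /= /and3P[-> -> _].
  move: lek mu12; rewrite mus /mu !big_cons big_nil; lia.
apply: subspB => //; apply: H => //=.
- by rewrite (ltn_trans ac bc) (ltn_trans bc db).
- by rewrite /mu !big_cons big_nil /=; nia.
- exact: leq_ltn_trans ac.
- by rewrite ac db.
- by rewrite /mu !big_cons big_nil /=; nia.
- exact: leq_ltn_trans bc.
Qed.

End Straightening.

(** * Coefficients of products of linear forms *)

Section ProdCoefficient.
Variable V : comNzRingType.

(** Truncating every factor at degree m leaves the coefficient of degree m unchanged, and lets the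
    exponents range over ['I_m.+1] as in [Ppoly]. *)
Lemma coef_prod_ffun (I : finType) (P : I -> {poly V}) (m : nat) :
  (\prod_i P i)`_m =
    \sum_(r : {ffun I -> 'I_m.+1} | (\sum_i r i == m)%N) \prod_i (P i)`_(r i).
Proof.
pose Q i := \sum_(j < m.+1) (P i)`_j *: 'X^j.
have PQ : forall i, (i <= m)%N -> (\prod_i P i)`_i = (\prod_i Q i)`_i.
  elim/big_ind2: _ => [|F1 G1 F2 G2 h1 h2|j _] i im //.
    rewrite !coefM; apply: eq_bigr => j _.
    by rewrite h1 ?h2 //; have := ltn_ord j; lia.
  rewrite /Q -poly_def coef_poly ltnS im //.
rewrite PQ // /Q bigA_distr_bigA coef_sum [RHS]big_mkcond /=; apply: eq_bigr => r _.
rewrite (eq_bigr (fun i => ((P i)`_(r i))%:P * 'X^(r i))); last by move=> i _; rewrite mul_polyC.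
rewrite big_split /= -rmorph_prod /= -expr_sum coefCM coefXn eq_sym.
by case: ifP; rewrite ?mulr1 ?mulr0.
Qed.

Lemma coef_linear_exp (a b : V) k r :
  ((a%:P + b *: 'X) ^+ k)`_r = 'C(k, r)%:R * (a ^+ (k - r) * b ^+ r).
Proof.
rewrite exprDn coef_sum.
have E (i : 'I_k.+1) : (a%:P ^+ (k - i) * (b *: 'X) ^+ i *+ 'C(k, i))`_r =
   (r == i)%:R * ('C(k, i)%:R * (a ^+ (k - i) * b ^+ i)).
  rewrite coefMn -rmorphXn /= exprZn coefCM coefZ coefXn -[LHS]mulr_natl; ring.
rewrite (eq_bigr _ (fun i _ => E i)); case: (leqP r k) => rk.
  rewrite (bigD1 (Ordinal (n:=k.+1) (m:=r) rk)) //= eqxx mul1r big1 ?addr0 // => i.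
  by rewrite -val_eqE /= eq_sym => /negPf ->; rewrite mul0r.
rewrite bin_small // mul0r big1 // => i _.
by rewrite (gtn_eqF (leq_trans (ltn_ord i) rk)) mul0r.
Qed.

Lemma coef_linear_mul0 (a b : V) (G : {poly V}) : ((a%:P + b *: 'X) * G)`_0 = a * G`_0.
Proof. by rewrite mulrDl coefD coefCM -scalerAl coefZ coefXM mulr0 addr0. Qed.
Lemma coef_linear_mulS (a b : V) (G : {poly V}) j :
  ((a%:P + b *: 'X) * G)`_j.+1 = a * G`_j.+1 + b * G`_j.
Proof. by rewrite mulrDl coefD coefCM -scalerAl coefZ coefXM. Qed.

End ProdCoefficient.

(** * The polynomials P_(k,K) as iterated polarizations *)

Section PpolyPolar.
Variables (K : numFieldType) (n : nat).
Notation A := {mpoly K[n + n]}.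
Notation x i := ('X_(lshift n i) : A).
Notation y i := ('X_(rshift n i) : A).
Implicit Types (i j t : 'I_n) (k : 'I_n -> nat) (Kf : 'I_n * 'I_n -> nat).

(** Generating function: the degree r coefficient of the product of the (x_t + y_t X)^(k_t) is the
    sum of the products of binom(k_t, r_t) x_t^(k_t - r_t) y_t^(r_t) over r_1 + ... + r_n = r. *)
Definition lin_form t : {poly A} := (x t)%:P + (y t) *: 'X.
Definition lin_prod k : {poly A} := \prod_t lin_form t ^+ k t.
Definition minor_prod Kf : A :=
  \prod_(i < n) \prod_(j < n | (i < j)%N) (x i * y j - x j * y i) ^+ Kf (i, j).

(** The coefficients form a string as in a representation of sl_2: polarization moves one step up,
    with the factor of d/dX, and the swap reverses the string. *)
Definition polar_chain d (G : {poly A}) : Prop :=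
  [/\ forall j : nat, (d < j)%N -> G`_j = 0,
      forall j : nat, polar G`_j = j.+1%:R * G`_j.+1
    & forall j : nat, (j <= d)%N -> swap_op G`_j = G`_(d - j)].

Lemma polar_chain_mul t d G : polar_chain d G -> polar_chain d.+1 (lin_form t * G).
Proof.
move=> [h1 h2 h3]; split.
- move=> [|j] // dj; rewrite coef_linear_mulS !h1 ?mulr0 ?addr0 //; exact: ltnW.
- move=> [|j]; rewrite ?coef_linear_mul0 coef_linear_mulS ?linearD /= !polarM !polar_x ?polar_y !h2.
    by ring.
  by rewrite coef_linear_mulS; ring.
- move=> [_|j jd].
    rewrite subn0 coef_linear_mul0 coef_linear_mulS (h1 d.+1) // mulr0 add0r.
    by rewrite swap_opM swap_opX h3 // bar_lshift subn0.
  rewrite ltnS in jd.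
  rewrite coef_linear_mulS linearD /= !swap_opM !swap_opX bar_lshift bar_rshift subSS (h3 j) //.
  have [lt|ge] := ltnP j d.
    by rewrite h3 // -[in RHS](subnSK lt) coef_linear_mulS addrC subnSK.
  have -> : j = d by apply/eqP; rewrite eqn_leq jd.
  by rewrite subnn coef_linear_mul0 (h1 d.+1) // linear0 mulr0 add0r.
Qed.

Lemma polar_chain_lin_prod k : polar_chain (\sum_t k t)%N (lin_prod k).
Proof.
rewrite /lin_prod; elim/big_rec2: _ => [|t d G _ h].
  split=> [[|j]|j|[|j]] //; rewrite ?coef1 //=.
    by case: j => [|j]; rewrite ?coef1 /= ?polar_1 ?linear0 mulr0.
  by rewrite /swap_op rmorph1.
by elim: (k t) => [|e IHe]; [rewrite mul1r | rewrite exprS addSn -mulrA; apply: polar_chain_mul].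
Qed.

Lemma polar_minor_prod Kf : polar (minor_prod Kf) = 0.
Proof.
rewrite /minor_prod; elim/big_ind: _ => [|f g hf hg|i _]; first exact: polar_1.
  by rewrite polarM hf hg mul0r mulr0 addr0.
elim/big_ind: _ => [|f g hf hg|j _]; first exact: polar_1.
  by rewrite polarM hf hg mul0r mulr0 addr0.
elim: (Kf _) => [|e IHe]; first exact: polar_1.
by rewrite exprS polarM IHe mulr0 addr0 linearB /= !polarM !polar_x !polar_y; ring.
Qed.

(** The factors 1, 2, ..., r met while climbing the string multiply to the factorial in P_(k,K); the
    minors pass through because L kills them. *)
Lemma pol_lin_prod k Kf r :
  pol r ((lin_prod k)`_0 * minor_prod Kf) = r`!%:R * ((lin_prod k)`_r * minor_prod Kf).
Proof.
have [_ h _] := polar_chain_lin_prod k.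
elim: r => [|r IHr]; first by rewrite mul1r.
rewrite polS IHr !mulr_natl linearMn /= polarM polar_minor_prod mulr0 addr0 h factS.
by rewrite -mulrA mulr_natl -mulrnA.
Qed.

Lemma lin_prod0 k : (lin_prod k)`_0 = \prod_t x t ^+ k t.
Proof.
rewrite /lin_prod coef0_prod; apply: eq_bigr => t _.
by rewrite coef_linear_exp bin0 mul1r subn0 mulr1.
Qed.

Lemma swap_minor_prod Kf : swap_op (minor_prod Kf) =
  (-1) ^+ (\sum_(i < n) \sum_(j < n | (i < j)%N) Kf (i, j))%N *: minor_prod Kf.
Proof.
have swM f1 e1 f2 e2 : swap_op f1 = (-1) ^+ e1 *: f1 -> swap_op f2 = (-1) ^+ e2 *: f2 ->
    swap_op (f1 * f2) = (-1) ^+ (e1 + e2)%N *: (f1 * f2).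
  by move=> h1 h2; rewrite swap_opM h1 h2 -scalerAl -scalerAr scalerA -exprD.
have sw1 : swap_op (1 : A) = (-1) ^+ 0%N *: 1 by rewrite expr0 scale1r /swap_op rmorph1.
rewrite /minor_prod; elim/big_ind2: _ => // [e f e' f' h h'|i _]; first exact: swM.
elim/big_ind2: _ => // [e f e' f' h h'|j _]; first exact: swM.
elim: (Kf _) => [|e IHe]; first exact: sw1.
rewrite exprS -add1n; apply: swM => //.
rewrite linearB /= !swap_opM !swap_opX !bar_lshift !bar_rshift expr1 scaleN1r opprB.
by rewrite mulrC ['X_(rshift n j) * _]mulrC.
Qed.

Section Charge.
Variable S : {set 'I_(n + n)}.
Hypothesis leftT : forall i, lshift n i \notin S.
Hypothesis rightS : forall i, rshift n i \in S.
Notation has_charge := (@has_charge K (n + n) S).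

Lemma has_chargeM c d f g : has_charge c f -> has_charge d g -> has_charge (c + d) (f * g).
Proof.
move=> hf hg m; rewrite -mcoeff_msupp => /msuppM_le /allpairsP[[m1 m2] /= [h1 h2 ->]].
by rewrite chargeD hf ?hg // -mcoeff_msupp.
Qed.

Lemma has_charge_x i : has_charge (-1) (x i).
Proof. by have := @has_chargeX K _ S U_(lshift n i)%MM; rewrite chargeU leftT. Qed.
Lemma has_charge_y i : has_charge 1 (y i).
Proof. by have := @has_chargeX K _ S U_(rshift n i)%MM; rewrite chargeU rightS. Qed.

Lemma has_charge_polar c f : has_charge c f -> has_charge (c + 2) (polar f).
Proof.
move=> hf; rewrite /polar; apply: (subsp_sum (has_charge_subspace _ _ _)) => i _.
rewrite addrC -[2]/(1 + 1) -addrA; apply: has_chargeM; first exact: has_charge_y.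
move=> m; rewrite mcoeff_deriv -mulr_natr mulf_eq0 negb_or => /andP[/hf h _].
by move: h; rewrite chargeD chargeU leftT /= => <-; rewrite addrC addrNK.
Qed.

Lemma has_charge_pol c r f : has_charge c f -> has_charge (c + (2 * r)%N%:Z) (pol r f).
Proof.
move=> hf; elim: r => [|r IHr]; first by rewrite muln0 addr0.
by rewrite mulnS addnC PoszD addrA; apply: has_charge_polar.
Qed.

Lemma has_charge_det i j : has_charge 0 (x i * y j - x j * y i).
Proof.
have xy i' j' : has_charge 0 (x i' * y j').
  by have := has_chargeM (@has_charge_x i') (@has_charge_y j'); rewrite addNr.
exact: (subspB (has_charge_subspace _ _ _)).
Qed.

Lemma has_charge_minors (s : seq ('I_n.+1 * 'I_n.+1)) :
  valid s -> has_charge (- (xcount s)%:Z) (minors K s).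
Proof.
elim: s => [_|[a b] s IHs /= /andP[ab vs]].
  by rewrite /minors big_nil oppr0; apply: has_charge1.
rewrite minors_cons PoszD opprD; apply: has_chargeM; last exact: IHs.
case: (unliftP ord0 b) => [j|] hb; last by rewrite hb in ab.
case: (unliftP ord0 a) => [i|] ha; rewrite ha hb.
  by rewrite minor_lift; apply: has_charge_det.
by rewrite minor0; apply: has_charge_x.
Qed.

Lemma has_charge_lin_prod k Kf :
  has_charge (- (\sum_t k t)%N%:Z) ((lin_prod k)`_0 * minor_prod Kf).
Proof.
rewrite -[- _]addr0; apply: has_chargeM.
  rewrite lin_prod0; elim/big_rec2: _ => [|t d f _ h]; first by rewrite oppr0; apply: has_charge1.
  rewrite PoszD opprD; apply: has_chargeM => //.
  elim: (k t) => [|e IHe]; first by rewrite oppr0; apply: has_charge1.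
  by rewrite exprS -add1n PoszD opprD; apply: has_chargeM => //; apply: has_charge_x.
rewrite /minor_prod; elim/big_ind: _ => [|f g hf hg|i _]; first exact: has_charge1.
  by rewrite -[0]addr0; apply: has_chargeM.
elim/big_ind: _ => [|f g hf hg|j _]; first exact: has_charge1.
  by rewrite -[0]addr0; apply: has_chargeM.
elim: (Kf _) => [|e IHe]; first exact: has_charge1.
by rewrite exprS -[0]addr0; apply: has_chargeM => //; apply: has_charge_det.
Qed.

End Charge.
End PpolyPolar.

Section Ppoly.
Variables (R : realType) (n : nat).
Notation K := R[i].
Notation A := {mpoly K[n + n]}.

Lemma PpolyE (p : Pidx n) : let m := (\sum_(t < n) p.1 t)%N./2 in
  Ppoly R p = m`!%:R * ((lin_prod K p.1)`_m * minor_prod K p.2).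
Proof.
have sc (c : nat) (f : A) : c%:R *: f = c%:R * f by rewrite -mul_mpolyC mpolyC_nat.
case: p => k Kf m; rewrite /Ppoly -/m /=.
rewrite /lin_prod coef_prod_ffun mulr_suml mulr_sumr; apply: eq_bigr => r /eqP ->.
rewrite sc; congr (_ * (_ * _)).
by apply: eq_bigr => t _; rewrite coef_linear_exp sc.
Qed.

Lemma Ppoly_pol (p : Pidx n) :
  Ppoly R p = pol (\sum_(t < n) p.1 t)%N./2 ((lin_prod K p.1)`_0 * minor_prod K p.2).
Proof. by rewrite PpolyE pol_lin_prod. Qed.

(** With 2m the sum of the k_t, the form h has charge -2m and L^m adds 2m. The swap fixes the middle
    coefficient, of degree m out of 2m, and changes the sign of each minor. *)
Lemma Ppoly_charge0 (p : Pidx n) b : P_index b p ->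
  charge0_part (~: initial n n) b (Ppoly R p).
Proof.
move=> pb; have [ev odb] : ~~ odd (\sum_(t < n) p.1 t)%N /\
    odd (\sum_(i < n) \sum_(j < n | (i < j)%N) p.2 (i, j)) = b.
  by case: p pb => k Kf /and5P[-> /eqP ->].
set m := (\sum_t _)%N in ev; have em : (2 * m./2 = m)%N by rewrite mul2n even_halfK.
split.
  have := @has_charge_pol K n _ (@lshift_S0 n) (@rshift_S0 n) _ m./2 _
    (@has_charge_lin_prod K n _ (@lshift_S0 n) (@rshift_S0 n) p.1 p.2).
  by rewrite -Ppoly_pol em addNr.
have [_ _ h3] := polar_chain_lin_prod K p.1.
rewrite PpolyE -/m swap_opM swap_opM swap_minor_prod h3 -/m; last by rewrite -{2}em; lia.
have -> : (m - m./2 = m./2)%N by rewrite -{1}em; lia.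
rewrite /swap_op rmorph_nat -!scalerAr; congr (_ *: _).
by rewrite -signr_odd odb.
Qed.

End Ppoly.

(** * The standard basis *)

(** The support of E is a chain for the componentwise order on positions. *)
Definition chain_matrix (a b : nat) (E : 'I_a -> 'I_b -> nat) : Prop :=
  forall (i i' : 'I_a) (j j' : 'I_b), (i < i')%N -> (j' < j)%N -> (E i j * E i' j' = 0)%N.

(* At the first entry where two such matrices differ, the smaller one must compensate further on
   both in the row and in the column, which breaks its chain condition. *)
Lemma chain_matrix_unique (a b : nat) (E E' : 'I_a -> 'I_b -> nat) :
  chain_matrix E -> chain_matrix E' ->
  (forall i, \sum_j E i j = \sum_j E' i j)%N ->
  (forall j, \sum_i E i j = \sum_i E' i j)%N ->
  forall i j, E i j = E' i j.
Proof.
have later (c : nat) (F G : 'I_c -> nat) (j : 'I_c) : (\sum_i F i = \sum_i G i)%N ->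
    (forall i : 'I_c, (i < j)%N -> F i = G i) -> (F j < G j)%N ->
    exists2 i : 'I_c, (j < i)%N & (0 < F i)%N.
  move=> sFG FG lt.
  case: (boolP [exists i : 'I_c, (j < i)%N && (G i < F i)%N]) => [/existsP[i /andP[ji h]]|].
    by exists i => //; apply: leq_ltn_trans h.
  move=> /existsPn h; suff : (\sum_i F i < \sum_i G i)%N by rewrite sFG ltnn.
  rewrite (bigD1 j) //= [X in (_ < X)%N](bigD1 j) //= -addSn leq_add // leq_sum // => i ij.
  have := h i; rewrite negb_and -!leqNgt => /orP[ij'|//].
  by rewrite FG ?leqnn // ltn_neqAle ij' andbT.
have main E1 E2 :
    chain_matrix E1 ->
    (forall i, \sum_(j < b) E1 i j = \sum_j E2 i j)%N ->
    (forall j, \sum_(i < a) E1 i j = \sum_i E2 i j)%N -> forall (i : 'I_a) (j : 'I_b),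
    (forall (i' : 'I_a) j', (i' < i)%N -> E1 i' j' = E2 i' j') ->
    (forall j' : 'I_b, (j' < j)%N -> E1 i j' = E2 i j') -> ~~ (E1 i j < E2 i j)%N.
  move=> ch rows cols i j hr hc; apply/negP => lt.
  have [j1 jj1 p1] := later _ (E1 i) (E2 i) j (rows i) hc lt.
  have [i1 ii1 p2] := later _ (E1^~ j) (E2^~ j) i (cols j) (fun i' h => hr i' j h) lt.
  by have /eqP := ch i i1 j1 j ii1 jj1; rewrite muln_eq0 (gtn_eqF p1) (gtn_eqF p2).
move=> ch ch' rows cols i j.
have [k] := ubnP i; elim: k i j => // k IHi i j; rewrite ltnS => lik.
have [l] := ubnP j; elim: l j => // l IHj j; rewrite ltnS => ljl.
have hr (i' : 'I_a) j' : (i' < i)%N -> E i' j' = E' i' j'.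
  by move=> h; apply: IHi; apply: leq_trans lik.
have hc (j' : 'I_b) : (j' < j)%N -> E i j' = E' i j'.
  by move=> h; apply: IHj; apply: leq_trans ljl.
case: (ltngtP (E i j) (E' i j)) => // lt; exfalso; apply/negP: lt.
  exact: main.
exact: (main E' E ch' (fun i => esym (rows i)) (fun j => esym (cols j)) i j
  (fun i' j' h => esym (hr i' j' h)) (fun j' h => esym (hc j' h))).
Qed.

Section Lead.
Variables (K : numFieldType) (n : nat).
Notation A := {mpoly K[n + n]}.
Notation x i := ('X_(lshift n i) : A).
Notation y i := ('X_(rshift n i) : A).
Implicit Types (i j t : 'I_n).

(** The form h with each factor x_t^(k_t) turned into x_(n+t)^(k_t); a multiple of it is what L^m
    leaves of P_(k,K), see [pol_Ppoly]. *)
Definition top_form (p : Pidx n) : A := \prod_t y t ^+ p.1 t * minor_prod K p.2.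

(** In equal degree the monomial order compares the exponents of the lowest indices first, and x_i
    precedes x_j. *)
Lemma mlead_det i j : (i < j)%N ->
  mlead (x i * y j - x j * y i) = (U_(lshift n i) + U_(rshift n j))%MM.
Proof.
move=> ij; rewrite -!mpolyXD mleadDl ?mleadN !mleadXm //.
apply/ltmcP; first by rewrite !mdegD !mdeg1.
have E (a b c : 'I_(n + n)) : (U_(a) + U_(b))%MM c = ((a == c) + (b == c))%N.
  by rewrite mnmDE !mnm1E.
exists (lshift n i) => [c ci|]; rewrite !E -!val_eqE /=; have := ltn_ord i; have := ltn_ord j.
  by move: ci => /=; lia.
by lia.
Qed.

Lemma det_neq0 i j : (i < j)%N -> (x i * y j - x j * y i : A) != 0.
Proof.
move=> ij; apply/eqP => e; have := mlead_det ij; rewrite e mlead0 => /esym /eqP.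
by rewrite -mdeg_eq0 mdegD !mdeg1.
Qed.

Lemma minor_prod_lead Kf : minor_prod K Kf != 0 /\
  forall a, mlead (minor_prod K Kf) a = (\sum_(i < n) \sum_(j < n | (i < j)%N)
    ((lshift n i == a) + (rshift n j == a)) * Kf (i, j))%N.
Proof.
have nz i j : (i < j)%N -> (x i * y j - x j * y i) ^+ Kf (i, j) != 0 :> A.
  by move=> ij; apply/expf_neq0/det_neq0.
have nz' i : \prod_(j < n | (i < j)%N) (x i * y j - x j * y i) ^+ Kf (i, j) != 0 :> A.
  by apply/prodf_neq0 => j; apply: nz.
split=> [|a]; first by apply/prodf_neq0 => i _.
rewrite mlead_prod // mnm_sumE; apply: eq_bigr => i _.
rewrite mlead_prod; last by move=> j _; apply: nz.
rewrite mnm_sumE; apply: eq_bigr => j ij.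
by rewrite mleadX ?det_neq0 // mlead_det // mulmnE mnmDE !mnm1E.
Qed.

End Lead.

Lemma seq_argmax (T : eqType) (d : Order.disp_t) (O : orderType d) (f : T -> O) (s : seq T) x0 :
  x0 \in s -> exists2 x, x \in s & forall y, y \in s -> (f y <= f x)%O.
Proof.
elim: s x0 => // a [|b s] IHs x0 _.
  by exists a; rewrite ?mem_head // => y; rewrite inE => /eqP ->.
have [x xs hx] := IHs b (mem_head b s).
case: (leP (f x) (f a)) => h; [exists a|exists x].
- exact: mem_head.
- by move=> y; rewrite inE => /predU1P[-> //|/hx /le_trans]; apply.
- by rewrite inE xs orbT.
- by move=> y; rewrite inE => /predU1P[->|/hx //]; apply: ltW.
Qed.

(** * Leading monomials determine the index *)

Section Independence.
Variables (K : numFieldType) (n : nat).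
Notation A := {mpoly K[n + n]}.
Notation x i := ('X_(lshift n i) : A).
Notation y i := ('X_(rshift n i) : A).
Implicit Types (i j t : 'I_n) (p : Pidx n).

(* The row k of p on top of the matrix (k_(i,j)). *)
Definition ext_matrix p (a : 'I_n.+1) j : nat :=
  if unlift ord0 a is Some i then p.2 (i, j) else p.1 j.

Lemma P_index_diag b p i j : P_index b p -> (j <= i)%N -> p.2 (i, j) = 0%N.
Proof. by case: p => k Kf /and5P[_ _ /'forall_forallP/(_ i j)/implyP h _ _] /h /eqP. Qed.

(** The condition k_(i,j) k_t = 0 for i < j < t compares the top row with a later one, and the
    condition on two nested pairs compares two later rows. Entries off i < j vanish, which disposes
    of the remaining positions. *)
Lemma P_index_chain b p : P_index b p -> chain_matrix (ext_matrix p).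
Proof.
move=> pb; have dg := P_index_diag pb.
case: p pb dg => k Kf /and5P[_ _ _ h4 h5] /= dg a a' j j'.
rewrite /ext_matrix; case: (unliftP ord0 a') => [i'|] -> //=.
case: (leqP j' i') => [h _ _|ij']; first by rewrite (dg i' j' h) muln0.
case: (unliftP ord0 a) => [i|] -> //= ii jj; last first.
  rewrite mulnC; apply/eqP.
  by move/'forall_forallP/(_ i' j')/forallP/(_ j)/implyP: h4; apply; rewrite ij'.
case: (leqP j i) => [h|ij]; first by rewrite (dg i j h).
apply/eqP; move/'forall_forallP/(_ i j)/'forall_forallP/(_ i' j')/implyP: h5; apply.
by rewrite ij ij' jj /= andbT; move: ii; rewrite /bump /=; lia.
Qed.

(** Leading monomials multiply, and a minor contributes x_i y_j; so the exponents are row sums and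
    column sums of the extended matrix, the top row entering only the latter. *)
Lemma top_form_lead b p : P_index b p -> top_form K p != 0 /\
  (forall i, mlead (top_form K p) (lshift n i) = (\sum_j ext_matrix p (lift ord0 i) j)%N) /\
  (forall j, mlead (top_form K p) (rshift n j) = (\sum_a ext_matrix p a j)%N).
Proof.
move=> pb; have dg := P_index_diag pb; have [nz hl] := minor_prod_lead K p.2.
have nzy : \prod_t y t ^+ p.1 t != 0.
  by apply/prodf_neq0 => t _; apply/expf_neq0/mpolyX_neq0.
have E a : mlead (top_form K p) a = (\sum_t (rshift n t == a) * p.1 t +
    \sum_(i < n) \sum_(j < n) ((lshift n i == a) + (rshift n j == a)) * p.2 (i, j))%N.
  rewrite /top_form mleadM // mnmDE hl mlead_prod; last first.
    by move=> t _ _; apply/expf_neq0/mpolyX_neq0.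
  rewrite mnm_sumE; congr (_ + _)%N; apply: eq_bigr => i _.
    by rewrite mleadX ?mpolyX_neq0 // mleadXm mulmnE mnm1E.
  rewrite big_mkcond /=; apply: eq_bigr => j _.
  by case: ltnP => // h; rewrite dg ?muln0.
have D (m : nat) (c : 'I_m) (F : 'I_m -> nat) : (\sum_i (i == c) * F i = F c)%N.
  by rewrite (bigD1 c) //= eqxx mul1n big1 ?addn0 // => i /negPf ->.
split; first by rewrite mulf_neq0.
split=> c; rewrite E.
  rewrite big1 => [|t _]; last by rewrite eq_rlshift.
  rewrite add0n -(D _ c (fun i => \sum_j ext_matrix p (lift ord0 i) j)%N).
  apply: eq_bigr => i _; rewrite big_distrr /=; apply: eq_bigr => j _.
  by rewrite (inj_eq (@lshift_inj _ _)) eq_rlshift addn0 /ext_matrix liftK.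
rewrite big_ord_recl; congr (_ + _)%N.
  rewrite -[RHS](D _ c (ext_matrix p ord0)); apply: eq_bigr => i _.
  by rewrite (inj_eq (@rshift_inj _ _)) /ext_matrix unlift_none.
apply: eq_bigr => i _; rewrite -[RHS](D _ c (ext_matrix p (lift ord0 i))).
apply: eq_bigr => j _.
by rewrite (inj_eq (@rshift_inj _ _)) eq_lrshift add0n /ext_matrix liftK.
Qed.

(** The hypothesis on the sums of the k_t supplies the one row sum, that of the top row, which the
    leading monomial does not give directly; [chain_matrix_unique] then applies. *)
Lemma top_form_inj b p p' : P_index b p -> P_index b p' ->
  (\sum_t p.1 t = \sum_t p'.1 t)%N -> mlead (top_form K p) = mlead (top_form K p') -> p = p'.
Proof.
move=> pb pb' sk eqm.
have [_ [l1 l2]] := top_form_lead pb; have [_ [l1' l2']] := top_form_lead pb'.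
have H := chain_matrix_unique (P_index_chain pb) (P_index_chain pb').
have {}H : forall a j, ext_matrix p a j = ext_matrix p' a j.
  apply: H => [a|j]; last by rewrite -l2 -l2' eqm.
  case: (unliftP ord0 a) => [i|] ->; first by rewrite -l1 -l1' eqm.
  by rewrite /ext_matrix unlift_none.
case: p p' H {pb pb' sk eqm l1 l2 l1' l2'} => k Kf [k' Kf'] H; congr (_, _); apply/ffunP.
  by move=> j; have := H ord0 j; rewrite /ext_matrix unlift_none.
by case=> i j; have := H (lift ord0 i) j; rewrite /ext_matrix liftK.
Qed.

Lemma lin_prod_top p : (lin_prod K p.1)`_(\sum_t p.1 t) = \prod_t y t ^+ p.1 t.
Proof.
have [_ _ h] := polar_chain_lin_prod K p.1.
rewrite -[X in _`_X]subn0 -h // lin_prod0 /swap_op rmorph_prod /=; apply: eq_bigr => t _.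
by rewrite rmorphXn /= -[msym _ _]/(swap_op _) swap_opX bar_lshift.
Qed.

End Independence.

(** * Independence and spanning of the P_(k,K) *)

Section Basis.
Variables (R : realType) (n : nat).
Notation K := R[i].
Notation A := {mpoly K[n + n]}.
Notation x i := ('X_(lshift n i) : A).
Notation y i := ('X_(rshift n i) : A).
Notation P := (@Ppoly R n).
Implicit Types (i j t : 'I_n) (p : Pidx n).

(** With 2m the sum of the k_t, L^M P = L^(M+m) h involves the coefficient of degree M + m in a
    product of degree 2m: the top one for M = m, zero for M > m. *)
Lemma pol_Ppoly b p M : P_index b p -> ((\sum_t p.1 t)./2 <= M)%N ->
  pol M (P p) = if (\sum_t p.1 t)./2 == M then (2 * M)`!%:R * top_form K p else 0.
Proof.
move=> pb; have ev : ~~ odd (\sum_t p.1 t) by case: p pb => k Kf /and5P[].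
have em : (2 * (\sum_t p.1 t)./2 = \sum_t p.1 t)%N by rewrite mul2n even_halfK.
move: em; set w := (\sum_t _)./2 => em wM; have [h0 _ _] := polar_chain_lin_prod K p.1.
rewrite Ppoly_pol -/w -polD pol_lin_prod.
case: eqP => [<-|ne]; last by rewrite h0 ?mul0r ?mulr0 // -em; lia.
by rewrite (addnn w) -(mul2n w) em lin_prod_top.
Qed.

(** Among the indices with nonzero coefficient, p1 has maximal m, and p2 has the largest leading
    monomial among those with this same m. After L^m, only p2 contributes to that monomial. *)
Lemma Ppoly_independent b (s : seq (Pidx n)) (c : Pidx n -> K) :
  uniq s -> all (P_index b) s -> \sum_(p <- s) c p *: P p = 0 -> forall p, p \in s -> c p = 0.
Proof.
move=> us /allP sb e0 p0 p0s; apply/eqP; apply: contraT => c0.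
pose w p := (\sum_t p.1 t)./2.
have p0s' : p0 \in [seq p <- s | c p != 0] by rewrite mem_filter c0.
have [p1 + wmax] := seq_argmax w p0s'; rewrite mem_filter => /andP[c1 p1s].
have p1s' : p1 \in [seq p <- s | (c p != 0) && (w p == w p1)] by rewrite mem_filter c1 eqxx.
have [p2 + lmax] := seq_argmax (fun p => mlead (top_form K p)) p1s'.
rewrite mem_filter => /andP[/andP[c2 /eqP w2] p2s].
have := congr1 (fun f => (pol (w p1) f)@_(mlead (top_form K p2))) e0.
rewrite linear_sum raddf_sum linear0 mcoeff0 /= (bigD1_seq p2) //= big1_seq ?addr0.
  rewrite linearZ mcoeffZ /= (pol_Ppoly (sb _ p2s)) -?w2 // eqxx => /eqP.
  rewrite mulf_eq0 (negPf c2) /= mulr_natl mcoeffMn mulrn_eq0 mleadc_eq0.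
  by rewrite (negPf (top_form_lead _ (sb _ p2s)).1) orbF -leqn0 leqNgt fact_gt0.
move=> p /andP[p2p ps]; rewrite linearZ mcoeffZ /=.
case: (eqVneq (c p) 0) => [->|cp]; first by rewrite mul0r.
have wp : (w p <= w p1)%N by apply: wmax; rewrite mem_filter cp.
rewrite (pol_Ppoly (sb _ ps)) //; case: eqP => [wp1|_]; last by rewrite mcoeff0 mulr0.
rewrite mulr_natl mcoeffMn mcoeff_gt_mlead ?mul0rn ?mulr0 //.
rewrite lt_neqAle lmax ?andbT; last by rewrite mem_filter cp ps [w p]wp1 eqxx.
apply: contra p2p => /eqP e; apply/eqP.
apply: (top_form_inj (sb _ ps) (sb _ p2s) _ e).
have ev q : P_index b q -> (\sum_t q.1 t = (w q).*2)%N.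
  by move=> qb; rewrite even_halfK //; case: q qb => k Kf /and5P[].
by rewrite !(ev _ (sb _ _)) // [w p]wp1 w2.
Qed.

Definition idx_of (s : seq ('I_n.+1 * 'I_n.+1)) : Pidx n :=
  ([ffun t => count_mem (ord0, lift ord0 t) s],
   [ffun e => count_mem (lift ord0 e.1, lift ord0 e.2) s]).

Lemma valid_count0 (s : seq ('I_n.+1 * 'I_n.+1)) (a b : 'I_n.+1) :
  valid s -> (b <= a)%N -> count_mem (a, b) s = 0%N.
Proof. by move=> /allP vs ba; apply/count_memPn; apply/negP => /vs /=; rewrite ltnNge ba. Qed.

Lemma prod_count (V : comNzRingType) (I : finType) (F : I -> V) (s : seq I) :
  \prod_(e <- s) F e = \prod_e F e ^+ count_mem e s.
Proof.
elim: s => [|e s IHs]; first by rewrite big_nil big1.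
rewrite big_cons IHs /= [RHS](eq_bigr (fun c => F c ^+ (e == c) * F c ^+ count_mem c s)).
  rewrite big_split /=; congr (_ * _).
  by rewrite (bigD1 e) //= eqxx big1 ?mulr1 // => c; rewrite eq_sym => /negPf ->.
by move=> c _; rewrite exprD.
Qed.

Lemma minors_idx s : valid s ->
  minors K s = (lin_prod K (idx_of s).1)`_0 * minor_prod K (idx_of s).2.
Proof.
move=> vs; rewrite /minors prod_count lin_prod0.
rewrite -(pair_bigA _ (fun a b => minor K a b ^+ count_mem (a, b) s)) /=.
rewrite big_ord_recl; congr (_ * _).
  rewrite big_ord_recl (valid_count0 vs) // mul1r.
  by apply: eq_bigr => t _; rewrite minor0 ffunE.
apply: eq_bigr => i _; rewrite big_ord_recl (valid_count0 vs) // mul1r big_mkcond [RHS]big_mkcond.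
apply: eq_bigr => j _ /=; case: ltnP => ij; first by rewrite minor_lift ffunE.
by rewrite (valid_count0 vs) // !lift0.
Qed.

Lemma xcount_idx s : valid s -> (\sum_t (idx_of s).1 t = xcount s)%N.
Proof.
move=> vs; under eq_bigr do rewrite ffunE.
elim: s vs => [_|[a b] s IHs /= /andP[ab vs]]; first by rewrite big1.
rewrite big_split /= IHs // /xcount /=; congr (_ + _)%N.
case: (unliftP ord0 b) => [j|] hb; last by rewrite hb in ab.
rewrite (bigD1 j) //= hb xpair_eqE eqxx andbT big1 ?addn0 // => t tj.
by rewrite xpair_eqE (inj_eq (@lift_inj _ _)) [j == t]eq_sym (negPf tj) andbF.
Qed.

(** Both vanishing conditions are instances of non-nesting: (i, j) lies inside (0, t) when i < j <
    t, and (i_1, j_1) inside (i, j) when i < i_1 and j_1 < j. *)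
Lemma P_index_idx s : valid s -> standard s -> ~~ odd (xcount s) ->
  P_index (odd (\sum_(i < n) \sum_(j < n | (i < j)%N) (idx_of s).2 (i, j))) (idx_of s).
Proof.
move=> vs st ev; rewrite /P_index /idx_of -/(idx_of s).
have h0 (a b : 'I_n.+1) : count_mem (a, b) s != 0%N -> (a, b) \in s.
  by apply: contraR => /count_memPn ->.
have nest e e' : e \in s -> e' \in s -> ~~ nested e e'.
  by move=> es e's; have /allP/(_ e es)/allP/(_ e' e's) := st.
rewrite (xcount_idx vs) ev eqxx /=; apply/and3P; split.
- apply/'forall_forallP => i j; apply/implyP => ji.
  by rewrite ffunE (valid_count0 vs) // !lift0.
- apply/'forall_forallP => i j; apply/forallP => t; apply/implyP => /andP[ij jt].
  rewrite !ffunE; apply: contraT; rewrite muln_eq0 negb_or => /andP[/h0 e1 /h0 e2].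
  by have := nest _ _ e2 e1; rewrite /nested /= /bump /=; lia.
- apply/'forall_forallP => i j; apply/'forall_forallP => i1 j1.
  apply/implyP => /and4P[ij ij1 ii jj].
  rewrite !ffunE; apply: contraT; rewrite muln_eq0 negb_or => /andP[/h0 e1 /h0 e2].
  by have := nest _ _ e1 e2; rewrite /nested /= /bump /=; lia.
Qed.

Notation Pspan b := (lspan (fun v => exists2 p, P_index b p & v = P p)).
Notation S0 := (~: initial n n).

Definition Pspans (f : A) : Prop := exists u1 u2, [/\ Pspan false u1, Pspan true u2 & f = u1 + u2].

Lemma Pspans_subspace : is_subspace Pspans.
Proof.
split; first by exists 0, 0; rewrite addr0; split=> //; apply: (lspan_subspace _).1.
move=> c f g [u1 [u2 [h1 h2 ->]]] [v1 [v2 [g1 g2 ->]]].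
exists (c *: u1 + v1), (c *: u2 + v2); split; try exact: (lspan_subspace _).2.
by rewrite scalerDr addrACA.
Qed.

Lemma Pspans_standard r s : valid s -> standard s -> xcount s = (2 * r)%N ->
  Pspans (pol r (minors K s)).
Proof.
move=> vs st xs.
have ev : ~~ odd (xcount s) by rewrite xs mul2n odd_double.
have pb := P_index_idx vs st ev.
have <- : P (idx_of s) = pol r (minors K s).
  by rewrite Ppoly_pol (xcount_idx vs) xs mul2n doubleK -minors_idx.
case: (odd _) pb => pb; [exists 0, (P (idx_of s))|exists (P (idx_of s)), 0];
  rewrite ?addr0 ?add0r; split=> //; try exact: (lspan_subspace _).1.
- by apply: lspan_gen; exists (idx_of s).
- by apply: lspan_gen; exists (idx_of s).
Qed.

(** Expand f in the vectors L^r h and project onto charge 0. Those with 2r different from the number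
    of factors x_j disappear, and straightening turns each of the others into a combination of the
    P_(k,K). *)
Lemma Pspans_charge0 f : has_charge S0 0 f -> Pspans f.
Proof.
move=> f0; pose pr := diag_op (fun m => (charge S0 m == 0)%:R : K) : A -> A.
have prE f' : has_charge S0 0 f' -> pr f' = f'.
  move=> h; apply/mpolyP => m; rewrite mcoeff_diag.
  by case: (eqVneq f'@_m 0) => [->|/h ->]; rewrite ?mulr0 ?eqxx ?mul1r.
rewrite -(prE f f0).
apply: (@subsp_lspan _ _ (fun f => Pspans (pr f))) (pol_minors_full f).
  split.
    suff -> : pr 0 = 0 by apply: Pspans_subspace.1.
    by apply/mpolyP => m; rewrite mcoeff_diag mcoeff0 mulr0.
  move=> c u v hu hv.
  suff -> : pr (c *: u + v) = c *: pr u + pr v by apply: Pspans_subspace.2.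
  by apply/mpolyP => m; rewrite mcoeffD mcoeffZ !mcoeff_diag mcoeffD mcoeffZ; ring.
move=> _ [r [s [vs ->]]].
have ch := @has_charge_pol K n _ (@lshift_S0 n) (@rshift_S0 n) _ r _
  (@has_charge_minors K n _ (@lshift_S0 n) (@rshift_S0 n) _ vs).
case: (eqVneq (xcount s) (2 * r)%N) => [xs|xs]; last first.
  suff -> : pr (pol r (minors K s)) = 0 by apply: Pspans_subspace.1.
  apply/mpolyP => m; rewrite mcoeff_diag mcoeff0.
  case: (eqVneq (pol r (minors K s))@_m 0) => [->|/ch ->]; first by rewrite mulr0.
  by case: eqP => [|_]; [move: xs; lia | rewrite mul0r].
rewrite prE; last by move: ch; rewrite xs addNr.
apply: (@subsp_lspan _ _ (fun f => Pspans (pol r f))) (minors_standard K vs).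
  split; first by rewrite linear0; apply: Pspans_subspace.1.
  by move=> c u v hu hv; rewrite linearP; apply: Pspans_subspace.2.
by move=> _ [s' [vs' st' xs' ->]]; apply: Pspans_standard; rewrite ?xs'.
Qed.

Lemma Pspan_charge0 b f : Pspan b f -> charge0_part S0 b f.
Proof.
apply: subsp_lspan; first exact: charge0_part_subspace.
by move=> _ [p pb ->]; apply: Ppoly_charge0.
Qed.

(** Split a vector of parity b into combinations of P's of either parity; the component of the wrong
    parity then lies in both parts of A_<0>, so it is 0. *)
Lemma Ppoly_basis b : is_basis (@P_index n b) (@Ppoly R n) (@charge0_part K n S0 b).
Proof.
split; first exact: Ppoly_independent.
move=> f; split; last exact: Pspan_charge0.
move=> fb; have [u1 [u2 [h1 h2 e]]] := Pspans_charge0 fb.1.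
have [c1 c2] := (Pspan_charge0 h1, Pspan_charge0 h2).
case: b fb => fb.
  have c1' : charge0_part S0 true u1.
    have -> : u1 = f - u2 by rewrite e addrK.
    exact: (subspB (charge0_part_subspace _ _ _) fb c2).
  by rewrite e (charge0_part_disjoint c1 c1') add0r.
have c2' : charge0_part S0 false u2.
  have -> : u2 = f - u1 by rewrite e [u1 + u2]addrC addrK.
  exact: (subspB (charge0_part_subspace _ _ _) fb c1).
by rewrite e (charge0_part_disjoint c2 c2') addr0.
Qed.

End Basis.

Lemma is_basis_ext (K : fieldType) (V : lmodType K) (I : eqType) (D : pred I) (b : I -> V)
    (W W' : V -> Prop) :
  (forall v, W v <-> W' v) -> is_basis D b W -> is_basis D b W'.
Proof. by move=> e [free span]; split=> // w; split=> [/e/span|/span/e]. Qed.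

(** * Highest weight modules for T = {1, ..., n} *)

Section InitialN.
Variables (R : realType) (n : nat).
Hypothesis hn : (2 <= n)%N.
Notation S0 := (~: initial n n).

Lemma graded_piece_initial_irr (k : int) : k != 0 ->
  irreducible_module S0 (graded_piece R S0 k).
Proof.
move=> k0; have n0 : (0 < n)%N by lia.
pose c := if 0 <= k then rshift n (Ordinal n0) else lshift n (Ordinal n0).
apply: (@graded_piece_irreducible _ _ _ k c).
  rewrite /c; case: (lerP 0 k) => hk; first by rewrite rshift_S0.
  by rewrite (negPf (lshift_S0 _)) oppr_ge0 ltW.
move=> W subW sW a b f Wf fk.
exact: (sp_t_stable_charge subW sW (@lshift_S0 n) (@rshift_S0 n) k0).
Qed.

Lemma hw_module_graded_pos (k : nat) : (0 < k)%N ->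
  hw_module S0 (graded_piece R S0 k%:Z) (xvar R n (2 * n)%N ^+ k)
    (fund_wt R n n.-1 *+ k - fund_wt R n n *+ k.+1).
Proof.
move=> k0; have n0 : (0 < n)%N by lia.
apply: hw_module_initial_n => //; first by apply: graded_piece_initial_irr; lia.
have tn : (n.-1 < n)%N by lia.
rewrite (@xvarE R n (rshift n (Ordinal tn))) /=; last by lia.
apply/graded_pieceP.
by have := @has_charge_power R n S0 (rshift n (Ordinal tn)) k; rewrite rshift_S0.
Qed.

Lemma hw_module_graded_neg (k : nat) : (0 < k)%N ->
  hw_module S0 (graded_piece R S0 (- k%:Z)) (xvar R n n ^+ k)
    (fund_wt R n n.-1 *+ k - fund_wt R n n *+ k.+1).
Proof.
move=> k0; have n0 : (0 < n)%N by lia.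
have irr : irreducible_module S0 (graded_piece R S0 (- k%:Z)).
  by apply: graded_piece_initial_irr; lia.
have := @hw_module_initial_lt0 R n n (- k%:Z) n0 (leqnn n) _ irr.
rewrite abszN absz_nat opprK -pmulrn -opprD mulrNz => /(_ _).
have -> : k%:Z + 1 = k.+1 by lia.
by rewrite -pmulrn; apply; lia.
Qed.

Lemma hw_module_one : hw_module S0 (U_orbit S0 1) 1 (- fund_wt R n n).
Proof.
have n0 : (0 < n)%N by lia.
have := @hw_module_initial_n R n (U_orbit S0 1) 0 n0.
rewrite expr0 mulr0n sub0r mulr1n; apply; last exact: U_orbit_self.
exact: (U_orbit_charge0_irr (charge0_part_1 R n) (oner_neq0 _)).
Qed.

Lemma bracket_xvar : exists i j : 'I_n, [/\ (i.+1 = j)%N, (j.+1 = n)%N &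
  xvar R n n.-1 * xvar R n (2 * n)%N - xvar R n n * xvar R n (2 * n).-1%N = bracket R i j].
Proof.
have h1 : (n - 2 < n)%N by lia.
have h2 : (n - 1 < n)%N by lia.
exists (Ordinal h1), (Ordinal h2); split; rewrite /=; try lia.
rewrite (@xvarE R n (lshift n (Ordinal h1))) /=; last by lia.
rewrite (@xvarE R n (rshift n (Ordinal h2))) /=; last by lia.
rewrite (@xvarE R n (lshift n (Ordinal h2))) /=; last by lia.
by rewrite (@xvarE R n (rshift n (Ordinal h1))) //=; lia.
Qed.

End InitialN.

Theorem theorem2p10 (R : realType) (n : nat) (hn : (2 <= n)%N)
    (S T : {set 'I_(n + n)}) (hST : T = ~: S)
    (hS : S != set0) (hT : T != set0) :
  (both S :|: both T != set0 ->
     (forall k : int, irreducible_module S (graded_piece R S k)) /\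
     (both S != set0 -> both T != set0 ->
        forall k : int, ~ hw_type S (graded_piece R S k)) /\
     (both S = set0 \/ both T = set0 ->
        forall t : nat, (1 <= t <= n - 1)%N -> T = initial n t ->
        forall k : int,
          irreducible_module S (graded_piece R S k) /\
          (0 <= k ->
             hw_module S (graded_piece R S k) (xvar R n t.+1 ^+ `|k|%N)
               (fund_wt R n t *~ (- (k + 1)) + fund_wt R n t.+1 *~ k)) /\
          (k < 0 ->
             hw_module S (graded_piece R S k) (xvar R n t ^+ `|k|%N)
               (fund_wt R n t.-1 *~ (- k) + fund_wt R n t *~ (k - 1)))))
  /\
  (both S :|: both T = set0 -> T = initial n n ->
     (forall k : nat, (0 < k)%N ->
        let mu := fund_wt R n n.-1 *+ k - fund_wt R n n *+ k.+1 in
        (irreducible_module S (graded_piece R S k%:Z) /\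
         hw_module S (graded_piece R S k%:Z) (xvar R n (2 * n)%N ^+ k) mu) /\
        (irreducible_module S (graded_piece R S (- k%:Z)) /\
         hw_module S (graded_piece R S (- k%:Z)) (xvar R n n ^+ k) mu)) /\
     (let w := xvar R n n.-1 * xvar R n (2 * n)%N
               - xvar R n n * xvar R n (2 * n).-1%N in
      [/\ is_direct_sum (graded_piece R S 0) (U_orbit S 1) (U_orbit S w),
          irreducible_module S (U_orbit S (1 : {mpoly R[i][n + n]})) /\
            hw_module S (U_orbit S 1) 1 (- fund_wt R n n),
          irreducible_module S (U_orbit S w) /\
            hw_module S (U_orbit S w) w
              (fund_wt R n (n - 2)%N - fund_wt R n n *+ 2),
          is_basis (@P_index n false) (@Ppoly R n) (U_orbit S 1)
        & is_basis (@P_index n true) (@Ppoly R n) (U_orbit S w)])).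
Proof.
split.
  move=> h1.
  have irr k : irreducible_module S (graded_piece R S k).
    exact: (@irreducible_of_both R n S T k).
  split=> //; split.
    move=> /set0Pn[i hi] /set0Pn[j hj] k [f [sf _]].
    move: hi hj; rewrite !inE hST !inE => /andP[li ri] /andP[lj rj].
    exact: (singular_both_eq0 li ri lj rj sf).
  move=> _ t /andP[t0 tn] eT k; split; first exact: irr.
  have eS : S = ~: initial n t by rewrite -eT hST setCK.
  rewrite eS in irr *; split=> hk.
    by apply: hw_module_initial_ge0 => //; lia.
  by apply: hw_module_initial_lt0 => //; [lia | exact: ltW].
move=> _ eT.
have {hST hS hT eT} -> : S = ~: initial n n by rewrite -eT hST setCK.
split=> [k k0 mu|w].
  split; split.
  - by apply: graded_piece_initial_irr => //; lia.
  - exact: hw_module_graded_pos.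
  - by apply: graded_piece_initial_irr => //; lia.
  - exact: hw_module_graded_neg.
have [i [j [ij jn ew]]] := bracket_xvar R hn; rewrite /w ew.
have neij : i != j by rewrite -val_eqE /= -ij; lia.
have b0 := bracket_neq0 R neij.
have bc := charge0_part_bracket R i j.
have c1 := charge0_part_1 R n.
have n1 := oner_neq0 {mpoly R[i][n + n]}.
split.
- exact: U_orbit_direct_sum.
- by split; [exact: (U_orbit_charge0_irr c1 n1) | exact: hw_module_one].
- split; first exact: (U_orbit_charge0_irr bc b0).
  apply: hw_module_bracket => // k.
  rewrite !mxE -!val_eqE /= ltn_ord.
  (* The indices i and j are n - 2 and n - 1 in 0-based numbering, so they are exactly those outside
     the support of lambda_(n-2). *)
  have -> : (k == i :> nat) || (k == j :> nat) = ~~ (k < n - 2)%N.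
    by have := ltn_ord k; lia.
  by case: (k < n - 2)%N; rewrite /= ?mulr0n ?addr0 ?sub0r // opprD addrA subrr sub0r.
- apply: is_basis_ext (Ppoly_basis R n false) => f.
  by split=> /(U_orbit_charge0 c1 n1).
- apply: is_basis_ext (Ppoly_basis R n true) => f.
  by split=> /(U_orbit_charge0 bc b0).
Qed.
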